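(* Let $(M,\varphi,\xi,\eta,g)$ be a $3$-dimensional trans-Sasakian manifold of type $(\alpha,\beta)$ equipped with a Newman--Penrose frame $(\partial,\overline{\partial},\xi)$. Then the Ricci tensor $S$ of $M$ is given by $$S(\partial,\partial)=0,$$ $$S(\partial,\xi)=-\partial(\rho_{\mathrm{np}})=\beta_{\mathrm{np}}(\epsilon_{\mathrm{np}}-\overline{\rho_{\mathrm{np}}})-\xi(\beta_{\mathrm{np}})+\partial(\epsilon_{\mathrm{np}}),$$ $$S(\xi,\xi)=-2\xi(\rho_{\mathrm{np}})-2\rho_{\mathrm{np}}^2,$$ $$S(\partial,\overline{\partial})=-|\rho_{\mathrm{np}}|^2-2|\beta_{\mathrm{np}}|^2-(\rho_{\mathrm{np}}-\overline{\rho_{\mathrm{np}}})\epsilon_{\mathrm{np}}-\xi(\rho_{\mathrm{np}})-\rho_{\mathrm{np}}^2-\partial(\overline{\beta_{\mathrm{np}}})-\overline{\partial}(\beta_{\mathrm{np}}).$$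
   Context: An almost contact metric structure $(\varphi,\xi,\eta,g)$ on $M$: $\varphi$ a $(1,1)$-tensor, $\xi$ a vector field, $\eta$ a $1$-form, $g$ a Riemannian metric with $\varphi^2=-I+\eta\otimes\xi$, $\eta(\xi)=1$, $\varphi\xi=0$, $\eta\circ\varphi=0$, $g(\varphi X,\varphi Y)=g(X,Y)-\eta(X)\eta(Y)$. It is trans-Sasakian of type $(\alpha,\beta)$ ($\alpha,\beta$ smooth functions) if $(\nabla_X\varphi)Y=\alpha(g(X,Y)\xi-\eta(Y)X)+\beta(g(\varphi X,Y)\xi-\eta(Y)\varphi X)$, with $\nabla$ the Levi-Civita connection. Newman--Penrose frame: for an orthonormal frame $(e_1,e_2,\xi)$, put $\partial=\frac1{\sqrt2}(e_1-ie_2)$, $\overline{\partial}=\frac1{\sqrt2}(e_1+ie_2)$, chosen so that $\varphi\partial=i\partial$, $\varphi\overline{\partial}=-i\overline{\partial}$ (i.e. $\varphi e_1=e_2$). All tensors and $\nabla$ are extended complex-(multi)linearly, so $g(\xi,\xi)=g(\partial,\overline{\partial})=1$ and $g(\xi,\partial)=g(\partial,\partial)=g(\overline{\partial},\overline{\partial})=0$. Spin coefficients: $\sigma_{\mathrm{np}}=-g(\partial,\nabla_\partial\xi)$, $\rho_{\mathrm{np}}=g(\partial,\nabla_{\overline{\partial}}\xi)$, $\kappa_{\mathrm{np}}=-g(\partial,\nabla_\xi\xi)$, $\beta_{\mathrm{np}}=g(\overline{\partial},\nabla_\partial\partial)$, $\epsilon_{\mathrm{np}}=g(\overline{\partial},\nabla_\xi\partial)$.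 In these terms the trans-Sasakian condition of type $(\alpha,\beta)$ reads $\kappa_{\mathrm{np}}=\sigma_{\mathrm{np}}=0$, $\rho_{\mathrm{np}}=\beta+i\alpha$. For a function $f$, $\partial(f),\overline{\partial}(f),\xi(f)$ denote derivatives along these vector fields. $S(Y,Z)=\operatorname{tr}(X\mapsto R(X,Y)Z)$ with $R(X,Y)=[\nabla_X,\nabla_Y]-\nabla_{[X,Y]}$. *)

(* Defs.v *)
From HB Require Import structures.
From mathcomp Require Import all_boot all_order all_algebra.
From mathcomp Require Import all_classical all_reals all_analysis.
From mathcomp Require Import complex.

Set Implicit Arguments.
Unset Strict Implicit.
Unset Printing Implicit Defensive.

Import Order.TTheory GRing.Theory Num.Theory.
Import numFieldNormedType.Exports.

Local Open Scope classical_set_scope.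
Local Open Scope ring_scope.

(* Smooth manifolds: Hausdorff second countable spaces with a smooth atlas
   modelled on R^n. *)

(* h is of class C^k on V (only used for V open): all iterated partial
   derivatives of order at most k exist and are continuous on V. *)
Fixpoint Ck {R : realType} {n : nat} (k : nat) (V : set 'rV[R]_n)
    (h : 'rV[R]_n -> R) : Prop :=
  {in V, continuous h} /\
  if k is k'.+1 then
    forall i : 'I_n,
      {in V, forall x, derivable h x (delta_mx 0 i)} /\
      Ck k' V (fun x => 'D_(delta_mx 0 i) h x)
  else True.

Definition Cinfty {R : realType} {n : nat} (V : set 'rV[R]_n)
  (h : 'rV[R]_n -> R) : Prop := forall k, Ck k V h.

(* chart_inv is only meaningful on the image of chart_dom. *)
Record chart (R : realType) (n : nat) (M : topologicalType) := Chart {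
  chart_dom : set M;
  chart_map : M -> 'rV[R]_n;
  chart_inv : 'rV[R]_n -> M }.

Definition chart_image {R : realType} {n : nat} {M : topologicalType}
  (c : chart R n M) (U : set M) : set 'rV[R]_n :=
  chart_map c @` (U `&` chart_dom c).

Record chart_axiom {R : realType} {n : nat} {M : topologicalType}
    (c : chart R n M) : Prop := ChartAxiom {
  chart_dom_open : open (chart_dom c);
  chart_image_open : open (chart_image c setT);
  chart_mapK : {in chart_dom c, cancel (chart_map c) (chart_inv c)};
  chart_map_continuous : {in chart_dom c, continuous (chart_map c)};
  chart_inv_continuous : {in chart_image c setT, continuous (chart_inv c)} }.

Record manifold (R : realType) (n : nat) := Manifold {
  mcarrier :> topologicalType;
  atlas : set (chart R n mcarrier);
  manifold_hausdorff : hausdorff_space mcarrier;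
  manifold_second_countable : @second_countable mcarrier;
  atlas_chart : forall c, atlas c -> chart_axiom c;
  atlas_cover : forall p : mcarrier, exists2 c, atlas c & chart_dom c p;
  atlas_compatible : forall c c', atlas c -> atlas c' ->
    forall i : 'I_n,
      Cinfty (chart_image c (chart_dom c'))
             (fun x => chart_map c' (chart_inv c x) 0 i) }.

Section Manifold.
Context {R : realType} {n : nat} {M : manifold R n}.

(* For U open. *)
Definition smooth_on (U : set M) (f : M -> R) : Prop :=
  forall c, atlas c -> Cinfty (chart_image c U) (f \o chart_inv c).

Definition smooth_at (p : M) (f : M -> R) : Prop :=
  exists2 U : set M, open_nbhs p U & smooth_on U f.

(* A tangent vector at p is a derivation of the algebra of germs at p of smooth
   functions.  It is represented as a functional on all functions M -> R, with
   value 0 by convention on those which are not smooth near p, so that two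
   tangent vectors are equal iff they agree on germs of smooth functions. *)
Record derivation_at (p : M) (v : (M -> R) -> R) : Prop := DerivationAt {
  derivation_local : forall f g, smooth_at p f ->
    (\forall q \near p, f q = g q) -> v f = v g;
  derivation_linear : forall (a : R) f g, smooth_at p f -> smooth_at p g ->
    v (fun q => a * f q + g q) = a * v f + v g;
  derivation_leibniz : forall f g, smooth_at p f -> smooth_at p g ->
    v (fun q => f q * g q) = v f * g p + f p * v g;
  derivation_default : forall f, ~ smooth_at p f -> v f = 0 }.

Definition derivation_pred (p : M) : {pred ((M -> R) -> R^o)} :=
  fun v => `[< derivation_at p v >].

Fact derivation_submod (p : M) : submod_closed (derivation_pred p).
Proof.
split; first by apply/asboolP; split=> //= *; rewrite ?mulr0 ?mul0r ?addr0.
move=> a v w /asboolP[vl va vm v0] /asboolP[wl wa wm w0].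
apply/asboolP; split.
- by move=> f g sf fg; rewrite !fctE (vl f g) ?(wl f g).
- move=> b f g sf sg; rewrite !fctE va // wa // !scalerDr !mulrDr /GRing.scale /=.
  by rewrite addrACA !mulrA (mulrC a b).
- move=> f g sf sg; rewrite !fctE vm // wm // /GRing.scale /=.
  by rewrite !mulrDr !mulrDl addrACA !mulrA (mulrC a (f p)).
- by move=> f sf; rewrite !fctE v0 // w0 // scaler0 addr0.
Qed.

HB.instance Definition _ (p : M) :=
  GRing.isSubmodClosed.Build R ((M -> R) -> R^o) (derivation_pred p)
    (derivation_submod p).

Record tangent (p : M) := Tangent {
  tangent_fun :> (M -> R) -> R^o;
  _ : derivation_pred p tangent_fun }.

HB.instance Definition _ (p : M) := [isSub for @tangent_fun p].
HB.instance Definition _ (p : M) := [Choice of tangent p by <:].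
HB.instance Definition _ (p : M) :=
  [SubChoice_isSubLmodule of tangent p by <:].

(* Not necessarily continuous or smooth; smoothness is vsmooth_at.  A field
   on an open set U is represented by any total field extending it. *)
Definition vfield := forall p : M, tangent p.

Definition vderiv (X : vfield) (f : M -> R) : M -> R := fun p => X p f.

(* X is smooth in a neighbourhood of p. *)
Definition vsmooth_at (p : M) (X : vfield) : Prop :=
  \forall q \near p, forall f, smooth_at q f -> smooth_at q (vderiv X f).

(* insubd 0 v is v when v is a derivation at p, which is the case when X and Y
   are smooth near p, and 0 otherwise. *)
Definition lie_bracket (X Y : vfield) : vfield := fun p =>
  insubd 0 (fun f =>
    if `[< smooth_at p f >] then X p (vderiv Y f) - Y p (vderiv X f) else 0).

Definition tensor02 := forall p : M, tangent p -> tangent p -> R.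

Record riemannian_metric (g : tensor02) : Prop := RiemannianMetric {
  metric_sym : forall p x y, g p x y = g p y x;
  metric_linear : forall p x, scalar (g p x);
  metric_pos : forall p x, x != 0 -> 0 < g p x x;
  metric_smooth : forall p X Y, vsmooth_at p X -> vsmooth_at p Y ->
    smooth_at p (fun q => g q (X q) (Y q)) }.

(* The Levi-Civita connection, acting on germs of smooth vector fields: the
   axioms say that it restricts to every open subset.  The value of
   nabla X Y at p is unconstrained unless X and Y are smooth near p. *)
Record levi_civita (g : tensor02)
    (nabla : vfield -> vfield -> vfield) : Prop := LeviCivita {
  lc_smooth : forall p X Y, vsmooth_at p X -> vsmooth_at p Y ->
    vsmooth_at p (nabla X Y);
  lc_local : forall p X X' Y Y', vsmooth_at p X -> vsmooth_at p Y ->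
    (\forall q \near p, X q = X' q) -> (\forall q \near p, Y q = Y' q) ->
    nabla X Y p = nabla X' Y' p;
  lc_tensorial : forall p f X X' Y, smooth_at p f ->
    vsmooth_at p X -> vsmooth_at p X' -> vsmooth_at p Y ->
    nabla (fun q => f q *: X q + X' q) Y p
    = f p *: nabla X Y p + nabla X' Y p;
  lc_leibniz : forall p f X Y Y', smooth_at p f ->
    vsmooth_at p X -> vsmooth_at p Y -> vsmooth_at p Y' ->
    nabla X (fun q => f q *: Y q + Y' q) p
    = vderiv X f p *: Y p + f p *: nabla X Y p + nabla X Y' p;
  lc_torsion_free : forall p X Y, vsmooth_at p X -> vsmooth_at p Y ->
    nabla X Y p - nabla Y X p = lie_bracket X Y p;
  lc_metric : forall p X Y Z,
    vsmooth_at p X -> vsmooth_at p Y -> vsmooth_at p Z ->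
    vderiv Z (fun q => g q (X q) (Y q)) p
    = g p (nabla Z X p) (Y p) + g p (X p) (nabla Z Y p) }.

Definition curvature (nabla : vfield -> vfield -> vfield) (X Y Z : vfield) :
    vfield := fun p =>
  nabla X (nabla Y Z) p - nabla Y (nabla X Z) p - nabla (lie_bracket X Y) Z p.

(* The endomorphism x |-> R(x, Y) Z of the tangent space at p, computed with
   any field X smooth near p such that X p = x. *)
Definition curvature_op (nabla : vfield -> vfield -> vfield) (Y Z : vfield)
    (p : M) (x : tangent p) : tangent p :=
  xget 0 [set w | exists X : vfield,
    [/\ vsmooth_at p X, X p = x & w = curvature nabla X Y Z p]].

End Manifold.

Arguments vfield {R n} M.
Arguments tensor02 {R n} M.

Definition is_basis {K : fieldType} {V : lmodType K} {m : nat}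
    (b : 'I_m -> V) : Prop :=
  forall v : V, exists! c : 'rV[K]_m, v = \sum_i c 0 i *: b i.

(* The trace of an endomorphism, read off from its matrix in any basis. *)
Definition endo_trace {K : fieldType} {V : lmodType K} (L : V -> V) : K :=
  xget 0 [set t | exists (m : nat) (b : 'I_m -> V) (A : 'M[K]_m),
    [/\ is_basis b, forall j, L (b j) = \sum_i A i j *: b i & t = \tr A]].

Definition ricci {R : realType} {n : nat} {M : manifold R n}
    (nabla : vfield M -> vfield M -> vfield M) (Y Z : vfield M) : M -> R :=
  fun p => endo_trace (curvature_op nabla Y Z (p := p)).

Record almost_contact_metric (R : realType) (n : nat) (M : manifold R n) :=
    AlmostContactMetric {
  phi : forall p : M, {linear tangent p -> tangent p};
  xi : vfield M;
  eta : forall p : M, {scalar tangent p};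
  metric : tensor02 M;
  phi_smooth : forall p X, vsmooth_at p X ->
    vsmooth_at p (fun q => phi q (X q));
  xi_smooth : forall p, vsmooth_at p xi;
  eta_smooth : forall p X, vsmooth_at p X ->
    smooth_at p (fun q => eta q (X q));
  metricP : riemannian_metric metric;
  phi_phi : forall p x, phi p (phi p x) = - x + eta p x *: xi p;
  eta_xi : forall p, eta p (xi p) = 1;
  phi_xi : forall p, phi p (xi p) = 0;
  eta_phi : forall p x, eta p (phi p x) = 0;
  metric_phi : forall p x y,
    @metric p (phi p x) (phi p y) = @metric p x y - eta p x * eta p y }.

Arguments metric {R n M} _ p x y.

Definition trans_sasakian {R : realType} {n : nat} {M : manifold R n}
    (A : almost_contact_metric M) (nabla : vfield M -> vfield M -> vfield M)
    (alpha beta : M -> R) : Prop :=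
  [/\ smooth_on setT alpha, smooth_on setT beta &
  forall p X Y, vsmooth_at p X -> vsmooth_at p Y ->
    nabla X (fun q => phi A q (Y q)) p - phi A p (nabla X Y p)
    = alpha p *: (metric A p (X p) (Y p) *: xi A p - eta A p (Y p) *: X p)
    + beta p *: (metric A p (phi A p (X p)) (Y p) *: xi A p
                 - eta A p (Y p) *: phi A p (X p))].

(* (e1, e2, xi) is a smooth orthonormal frame on the open set U with
   phi e1 = e2. *)
Record np_frame {R : realType} {M : manifold R 3} (A : almost_contact_metric M)
    (U : set M) (e1 e2 : vfield M) : Prop := NPFrame {
  np_open : open U;
  np_smooth : forall p, U p -> vsmooth_at p e1 /\ vsmooth_at p e2;
  np_basis : forall p, U p -> is_basis (tnth [tuple e1 p; e2 p; xi A p]);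
  np_orthonormal : forall p, U p -> forall i j : 'I_3,
    metric A p (tnth [tuple e1 p; e2 p; xi A p] i)
               (tnth [tuple e1 p; e2 p; xi A p] j) = (i == j)%:R;
  np_phi : forall p, U p -> phi A p (e1 p) = e2 p }.

Section Complexification.
Context {R : realType} {n : nat} {M : manifold R n}.

(* The pair (X, Y) stands for the complex vector field X + iY. *)
Definition cvfield : Type := (vfield M * vfield M)%type.

Definition real_field (X : vfield M) : cvfield := (X, fun=> 0).

Definition cderiv (X : cvfield) (f : M -> R[i]) : M -> R[i] := fun p =>
  Complex (vderiv X.1 (fun q => complex.Re (f q)) p
           - vderiv X.2 (fun q => complex.Im (f q)) p)
          (vderiv X.1 (fun q => complex.Im (f q)) p
           + vderiv X.2 (fun q => complex.Re (f q)) p).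

(* Complex bilinear extensions of a real valued form and of the connection. *)
Definition cform (B : vfield M -> vfield M -> M -> R) (X Y : cvfield) :
    M -> R[i] := fun p =>
  Complex (B X.1 Y.1 p - B X.2 Y.2 p) (B X.1 Y.2 p + B X.2 Y.1 p).

Definition cnabla (nabla : vfield M -> vfield M -> vfield M)
    (X Y : cvfield) : cvfield :=
  (fun p => nabla X.1 Y.1 p - nabla X.2 Y.2 p,
   fun p => nabla X.1 Y.2 p + nabla X.2 Y.1 p).

Definition cmetric (g : tensor02 M) :
    cvfield -> cvfield -> M -> R[i] :=
  cform (fun X Y p => g p (X p) (Y p)).

Definition cricci (nabla : vfield M -> vfield M -> vfield M) :
    cvfield -> cvfield -> M -> R[i] :=
  cform (ricci nabla).

(* (e1 - i e2) / sqrt 2 and (e1 + i e2) / sqrt 2 *)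
Definition np_d (e1 e2 : vfield M) : cvfield :=
  (fun p => (Num.sqrt 2)^-1 *: e1 p, fun p => - ((Num.sqrt 2)^-1 *: e2 p)).
Definition np_dbar (e1 e2 : vfield M) : cvfield :=
  (fun p => (Num.sqrt 2)^-1 *: e1 p, fun p => (Num.sqrt 2)^-1 *: e2 p).

Variables (A : almost_contact_metric M).
Variable nabla : vfield M -> vfield M -> vfield M.
Variables e1 e2 : vfield M.

Definition rho_np : M -> R[i] :=
  cmetric (metric A) (np_d e1 e2)
    (cnabla nabla (np_dbar e1 e2) (real_field (xi A))).
Definition beta_np : M -> R[i] :=
  cmetric (metric A) (np_dbar e1 e2)
    (cnabla nabla (np_d e1 e2) (np_d e1 e2)).
Definition epsilon_np : M -> R[i] :=
  cmetric (metric A) (np_dbar e1 e2)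
    (cnabla nabla (real_field (xi A)) (np_d e1 e2)).

End Complexification.

Arguments cvfield {R n} M.

(* Main.v *)
Require Import Defs.
From mathcomp Require Import all_boot all_order all_algebra.
From mathcomp Require Import all_classical all_reals all_analysis.
From mathcomp Require Import complex.
From mathcomp Require Import ring lra.

(* In the real orthonormal frame (e1, e2, xi) the trans-Sasakian condition
   amounts to nabla_X xi = - alpha phi X + beta (X - eta(X) xi), so that all the
   Christoffel symbols are known up to the three functions
   a = g(nabla_e1 e1, e2), b = g(nabla_e2 e1, e2), c = g(nabla_xi e1, e2), and
   rho_np = beta + i alpha, beta_np = (b + i a) / sqrt 2, epsilon_np = i c.
   The curvature, hence the Ricci tensor, is a polynomial in alpha, beta, a, b,
   c and their first derivatives along the frame.  The identities that do not
   follow from expanding it, namely xi(alpha) = - 2 alpha beta and the second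
   expression of S(d, xi), are the components of the Jacobi identity for
   (e1, e2, xi). *)

Set Implicit Arguments.
Unset Strict Implicit.
Unset Printing Implicit Defensive.

Import Order.TTheory GRing.Theory Num.Theory.
Import numFieldNormedType.Exports.
Local Open Scope classical_set_scope.
Local Open Scope ring_scope.


(** [ricci] hides two choices: an extension of a tangent vector to a field, in [curvature_op], and a
    basis, in [endo_trace]. Before any expansion in the frame, both must be shown to be harmless.
    For the first this requires linearity of the curvature over smooth functions in its first
    argument; for the second, invariance of the trace under change of basis. In the other two
    arguments constant factors are enough, because the complex frame is obtained from the real one
    with the constants 1 / sqrt 2 and - 1 / sqrt 2.

    The frame is controlled on [U] only, and smoothness, brackets and [nabla] are meaningful only
    for germs. A formula that is going to be differentiated must therefore hold in a neighbourhood
    of the point, and each replacement of a field or a function by its formula passes through a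
    locality axiom. The Jacobi identity is a theorem about derivations here, obtained by cancelling
    third-order derivatives. *)

Lemma open_near {T : topologicalType} (V : set T) (x : T) (P : T -> Prop) :
  open V -> V x -> (forall y, V y -> P y) -> \forall y \near x, P y.
Proof.
by move=> oV Vx VP; apply: filterS VP _; apply: open_nbhs_nbhs; split.
Qed.

Lemma continuous_near_eq {S T : topologicalType} (f g : S -> T) (x : S) :
  (\forall y \near x, f y = g y) ->
  {for x, continuous f} -> {for x, continuous g}.
Proof.
move=> fg; have fgx := nbhs_singleton fg.
by rewrite /prop_for /continuous_at -fgx; apply: cvg_trans; apply: near_eq_cvg.
Qed.

(** * Smooth functions *)

Section Ck.
Context {R : realType} {n : nat}.
Implicit Types (V W : set 'rV[R]_n) (h : 'rV[R]_n -> R).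

Lemma Ck_cont k V h : Ck k V h -> forall x, V x -> {for x, continuous h}.
Proof. by case: k => [|k] [hc _] x Vx; apply: hc; rewrite inE. Qed.

Lemma Ck_pred k V h : Ck k.+1 V h -> Ck k V h.
Proof.
elim: k h => [|k IH] h [hc hd]; split=> // i; have [di Di] := hd i.
by split=> //; apply: IH.
Qed.

Lemma Ck_subset k V W h : W `<=` V -> Ck k V h -> Ck k W h.
Proof.
move=> WV; elim: k h => [|k IH] h [hc hd].
  by split=> // x; rewrite !inE => /WV Vx; apply: hc; rewrite inE.
split; first by move=> x; rewrite !inE => /WV Vx; apply: hc; rewrite inE.
move=> i; have [di Di] := hd i; split; last exact: IH.
by move=> x; rewrite !inE => /WV Vx; apply: di; rewrite inE.
Qed.

(** On an open set, continuity and partial derivatives depend only on nearby values. This is what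
    lets the sum and product rules, valid on [V] only, be used under the recursive call of [Ck]. *)
Lemma Ck_eq k V h h' : open V -> (forall x, V x -> h x = h' x) ->
  Ck k V h -> Ck k V h'.
Proof.
move=> oV; elim: k h h' => [|k IH] h h' hh' [hc hd].
  split=> // x; rewrite inE => Vx.
  by apply: continuous_near_eq (open_near oV Vx hh') (hc x _); rewrite inE.
have nV x : V x -> \near x, h x = h' x.
  by move=> Vx; exact: (open_near oV Vx hh').
split.
  move=> x; rewrite inE => Vx.
  by apply: continuous_near_eq (nV _ Vx) (hc x _); rewrite inE.
move=> i; have [di Di] := hd i; split.
  move=> x xV; apply: near_eq_derivable (di x xV).
  by apply: nV; rewrite inE in xV.
by apply: IH Di => x Vx; apply: near_eq_derive; apply: nV.
Qed.

Lemma CkD k V h h' : open V -> Ck k V h -> Ck k V h' -> Ck k V (h + h').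
Proof.
move=> oV; elim: k h h' => [|k IH] h h' hC hC'.
  split=> // x; rewrite inE => Vx.
  by apply: continuousD; [apply: (Ck_cont hC)|apply: (Ck_cont hC')].
split.
  move=> x; rewrite inE => Vx.
  by apply: continuousD; [apply: (Ck_cont hC)|apply: (Ck_cont hC')].
move=> i; case: hC => _ /(_ i)[di Di]; case: hC' => _ /(_ i)[di' Di']; split.
  by move=> x xV; apply: derivableD; [apply: di|apply: di'].
apply: Ck_eq (IH _ _ Di Di') => // x Vx; rewrite deriveD ?fctE //.
  by apply: di; rewrite inE.
by apply: di'; rewrite inE.
Qed.

Lemma CkM k V h h' : open V -> Ck k V h -> Ck k V h' -> Ck k V (h * h').
Proof.
move=> oV; elim: k h h' => [|k IH] h h' hC hC'.
  split=> // x; rewrite inE => Vx.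
  by apply: continuousM; [apply: (Ck_cont hC)|apply: (Ck_cont hC')].
split.
  move=> x; rewrite inE => Vx.
  by apply: continuousM; [apply: (Ck_cont hC)|apply: (Ck_cont hC')].
(* The product rule leaves one factor undifferentiated, so the induction hypothesis needs the
   factors themselves to be of class C^k, not only C^(k+1). *)
move=> i; have hCp := Ck_pred hC; have hCp' := Ck_pred hC'.
case: hC => _ /(_ i)[di Di]; case: hC' => _ /(_ i)[di' Di']; split.
  by move=> x xV; apply: derivableM; [apply: di|apply: di'].
apply: Ck_eq (CkD oV (IH _ _ hCp Di') (IH _ _ hCp' Di)) => // x Vx.
rewrite deriveM ?fctE //; first by apply: di; rewrite inE.
by apply: di'; rewrite inE.
Qed.

Lemma Ck_cst k V (a : R) : open V -> Ck k V (cst a).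
Proof.
move=> oV; elim: k a => [|k IH] a.
  by split=> // x _; apply: cst_continuous.
split=> [x _|i]; first exact: cst_continuous.
split=> [x _|]; first exact: derivable_cst.
by apply: Ck_eq (IH 0) => // x _; rewrite derive_cst.
Qed.

End Ck.

Section Smooth.
Context {R : realType} {n : nat} {M : manifold R n}.
Implicit Types (U V : set M) (f g : M -> R) (p : M).

(** The image is the part of the full chart image that [chart_inv] sends into [U]. Since [chart_inv]
    is continuous only at points of that full image, openness is checked point by point. *)
Lemma open_chart_image (c : chart R n M) U :
  atlas c -> open U -> open (chart_image c U).
Proof.
move=> /atlas_chart ca oU.
have -> : chart_image c U = chart_image c setT `&` chart_inv c @^-1` U.
  apply/seteqP; split=> x /=.
    move=> [q [Uq dq] <-]; split; first by exists q.
    by rewrite (chart_mapK ca) ?inE.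
  by move=> [[q [_ dq] <-]]; rewrite (chart_mapK ca) ?inE // => Uq; exists q.
have := chart_inv_continuous ca; have := chart_image_open ca.
rewrite !openE => oI cI x [Ix Ux]; apply: filterI; first exact: oI.
by apply: cI; [rewrite inE|move: oU; rewrite openE; apply].
Qed.

Lemma smooth_on_eq U V f g : open V -> V `<=` U ->
  (forall q, V q -> f q = g q) -> smooth_on U f -> smooth_on V g.
Proof.
move=> oV VU fg sf c ac k.
have oI := open_chart_image ac oV.
apply: (Ck_eq oI) (Ck_subset _ (sf c ac k)).
  move=> x [q [Vq dq] <-] /=; rewrite (chart_mapK (atlas_chart ac)) ?inE //.
  exact: fg.
by move=> x [q [Vq dq] <-]; exists q => //; split=> //; apply: VU.
Qed.

Lemma smooth_at_near p f : smooth_at p f -> \forall q \near p, smooth_at q f.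
Proof.
by move=> [U [oU Up] sf]; apply: (open_near oU Up) => q Uq; exists U.
Qed.

Lemma smooth_at_eq p f g :
  (\forall q \near p, f q = g q) -> smooth_at p f -> smooth_at p g.
Proof.
rewrite /prop_near1 nbhsE => -[V [oV Vp] fg] [U [oU Up] sf].
exists (U `&` V); first by split; [apply: openI|].
by apply: smooth_on_eq sf => [||q [_ /fg]//]; [apply: openI|move=> q []].
Qed.

Lemma smooth_at_op2 (op : R -> R -> R) p f g :
  (forall k (W : set 'rV[R]_n) (h h' : 'rV[R]_n -> R), open W ->
     Ck k W h -> Ck k W h' -> Ck k W (fun x => op (h x) (h' x))) ->
  smooth_at p f -> smooth_at p g -> smooth_at p (fun q => op (f q) (g q)).
Proof.
move=> opC [U [oU Up] sf] [V [oV Vp] sg].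
have oUV := openI oU oV.
exists (U `&` V); first by split.
move=> c ac k; apply: opC; first exact: open_chart_image.
  by apply: (smooth_on_eq (g := f) oUV _ _ sf ac) => // q [].
by apply: (smooth_on_eq (g := g) oUV _ _ sg ac) => // q [].
Qed.

Lemma smooth_atD p f g :
  smooth_at p f -> smooth_at p g -> smooth_at p (fun q => f q + g q).
Proof. by apply: smooth_at_op2 => k V h h'; apply: CkD. Qed.

Lemma smooth_atM p f g :
  smooth_at p f -> smooth_at p g -> smooth_at p (fun q => f q * g q).
Proof. by apply: smooth_at_op2 => k V h h'; apply: CkM. Qed.

Lemma smooth_at_cst p (a : R) : smooth_at p (fun=> a).
Proof.
exists setT; first by split=> //; apply: openT.
move=> c ac k; apply: Ck_cst; apply: open_chart_image => //.
exact: openT.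
Qed.

Lemma smooth_atN p f : smooth_at p f -> smooth_at p (fun q => - f q).
Proof.
move=> sf; apply: smooth_at_eq (smooth_atM (smooth_at_cst p (-1)) sf).
by apply: nearW => q; rewrite mulN1r.
Qed.

End Smooth.

(** * Vector fields and the Jacobi identity *)

Section Fields.
Context {R : realType} {n : nat} {M : manifold R n}.
Implicit Types (f g : M -> R) (p : M) (X Y Z : vfield M).

Lemma tangentP p (v : tangent p) : derivation_at p v.
Proof. by apply/asboolP; exact: valP v. Qed.

Lemma tangentD p (v w : tangent p) f : (v + w) f = v f + w f.
Proof. by []. Qed.
Lemma tangentN p (v : tangent p) f : (- v) f = - v f.
Proof. by []. Qed.
Lemma tangentZ p (a : R) (v : tangent p) f : (a *: v) f = a * v f.
Proof. by []. Qed.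
Lemma tangent0 p f : (0 : tangent p) f = 0.
Proof. by []. Qed.

Lemma tangent_eq p (v w : tangent p) :
  (forall f, smooth_at p f -> v f = w f) -> v = w.
Proof.
move=> vw; apply: val_inj; apply/funext => f; change (v f = w f).
have [sf|nf] := pselect (smooth_at p f); first exact: vw.
rewrite (derivation_default (tangentP v)) //.
by rewrite (derivation_default (tangentP w)).
Qed.

Lemma tangent_near p (v : tangent p) f g : smooth_at p f ->
  (\forall q \near p, f q = g q) -> v f = v g.
Proof. by move=> sf fg; exact: (derivation_local (tangentP v) sf fg). Qed.

Lemma tangent_cst p (v : tangent p) (a : R) : v (fun=> a) = 0.
Proof.
have s1 := smooth_at_cst p (1 : R); have s0 := smooth_at_cst p (0 : R).
have v1 : v (fun=> 1) = 0.
  have := derivation_leibniz (tangentP v) s1 s1.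
  rewrite (_ : (fun _ => 1 * 1) = fun=> 1); last first.
    by apply/funext => ?; rewrite mul1r.
  by rewrite mulr1 mul1r -[LHS]addr0 => /addrI.
(* The constant [a] is written as (a - 1) * 1 + 1 to fit the combined form of the linearity axiom;
   [v] kills 1 because 1 * 1 = 1. *)
have := derivation_linear (tangentP v) (a - 1) s1 s1.
rewrite (_ : (fun _ => _) = fun=> a); first by rewrite v1 mulr0 addr0.
by apply/funext => ?; rewrite mulr1 subrK.
Qed.

Lemma tangent_fD p (v : tangent p) f g : smooth_at p f -> smooth_at p g ->
  v (fun q => f q + g q) = v f + v g.
Proof.
move=> sf sg; have := derivation_linear (tangentP v) 1 sf sg.
rewrite mul1r => <-.
by congr (v _); apply/funext => q; rewrite mul1r.
Qed.

Lemma tangent_fM p (v : tangent p) f g : smooth_at p f -> smooth_at p g ->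
  v (fun q => f q * g q) = v f * g p + f p * v g.
Proof. by move=> sf sg; exact: (derivation_leibniz (tangentP v) sf sg). Qed.

Lemma tangent_fZ p (v : tangent p) (a : R) f : smooth_at p f ->
  v (fun q => a * f q) = a * v f.
Proof.
move=> sf; rewrite tangent_fM ?tangent_cst ?mul0r ?add0r //.
exact: smooth_at_cst.
Qed.

Lemma tangent_fN p (v : tangent p) f : smooth_at p f ->
  v (fun q => - f q) = - v f.
Proof.
move=> sf; apply/eqP; rewrite -addr_eq0 addrC -tangent_fD ?tangent_cst //.
  apply/eqP; rewrite -(tangent_cst v 0); congr (v _).
  by apply/funext => q; rewrite subrr.
exact: smooth_atN.
Qed.

Lemma tangent_fB p (v : tangent p) f g : smooth_at p f -> smooth_at p g ->
  v (fun q => f q - g q) = v f - v g.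
Proof.
by move=> sf sg; rewrite tangent_fD ?tangent_fN //; apply: smooth_atN.
Qed.

Lemma smooth_atB p f g :
  smooth_at p f -> smooth_at p g -> smooth_at p (fun q => f q - g q).
Proof. by move=> sf sg; apply: smooth_atD => //; apply: smooth_atN. Qed.

Lemma vsmooth_at_near p X : vsmooth_at p X -> \forall q \near p, vsmooth_at q X.
Proof. exact: near_join. Qed.

Lemma vderiv_smooth p X f :
  vsmooth_at p X -> smooth_at p f -> smooth_at p (vderiv X f).
Proof. by move=> sX; apply: (nbhs_singleton sX). Qed.

Lemma vsmooth_at_eq p X Y :
  (\forall q \near p, X q = Y q) -> vsmooth_at p X -> vsmooth_at p Y.
Proof.
move=> /near_join XY sX; apply: filterS2 XY sX => q XY sX f sf.
by apply: smooth_at_eq (sX f sf); apply: filterS XY => r; rewrite /vderiv => ->.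
Qed.

Lemma vsmooth_atZD p f X Y :
  smooth_at p f -> vsmooth_at p X -> vsmooth_at p Y ->
  vsmooth_at p (fun q => f q *: X q + Y q).
Proof.
move=> sf; apply: filterS3 (smooth_at_near sf) => q {}sf sX sY g sg.
by apply: smooth_atD (sY _ sg); apply: smooth_atM sf (sX _ sg).
Qed.

Lemma vsmooth_at0 p : vsmooth_at p (fun q => 0 : tangent q).
Proof. by apply: nearW => q f _; apply: smooth_at_cst. Qed.

Lemma vsmooth_atZ p f X : smooth_at p f -> vsmooth_at p X ->
  vsmooth_at p (fun q => f q *: X q).
Proof.
move=> sf sX; apply: vsmooth_at_eq (vsmooth_atZD sf sX (vsmooth_at0 p)).
by apply: nearW => q; rewrite addr0.
Qed.

Lemma vsmooth_atD p X Y : vsmooth_at p X -> vsmooth_at p Y ->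
  vsmooth_at p (fun q => X q + Y q).
Proof.
move=> sX sY; apply: vsmooth_at_eq (vsmooth_atZD (smooth_at_cst p 1) sX sY).
by apply: nearW => q; rewrite scale1r.
Qed.

Lemma vsmooth_atN p X : vsmooth_at p X -> vsmooth_at p (fun q => - X q).
Proof.
move=> sX; apply: vsmooth_at_eq (vsmooth_atZ (smooth_at_cst p (-1)) sX).
by apply: nearW => q; rewrite scaleN1r.
Qed.

Lemma vsmooth_atB p X Y : vsmooth_at p X -> vsmooth_at p Y ->
  vsmooth_at p (fun q => X q - Y q).
Proof. by move=> sX sY; apply: vsmooth_atD => //; apply: vsmooth_atN. Qed.

(** The default value of [insubd] is avoided by checking that the commutator is a derivation: in the
    Leibniz rule the mixed products of first derivatives cancel. The inner derivative of a
    combination or a product is known only where the functions are smooth, that is near [p], hence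
    the repeated use of [tangent_near]. *)
Lemma lie_bracketE p X Y f : vsmooth_at p X -> vsmooth_at p Y ->
  smooth_at p f -> lie_bracket X Y p f = X p (vderiv Y f) - Y p (vderiv X f).
Proof.
move=> sX sY sf; rewrite /lie_bracket.
set b : (M -> R) -> R^o := fun f => _.
have bE g : smooth_at p g -> b g = X p (vderiv Y g) - Y p (vderiv X g).
  by move=> sg; rewrite /b; case: asboolP.
have bP : derivation_pred p b.
  apply/asboolP; split.
  - move=> g h sg gh; have sh := smooth_at_eq gh sg; rewrite !bE //.
    have gh' Z : \forall q \near p, vderiv Z g q = vderiv Z h q.
      apply: filterS2 (smooth_at_near sg) (near_join gh) => q sgq ghq.
      exact: tangent_near.
    by rewrite (tangent_near (X p) _ (gh' Y))
         1?(tangent_near (Y p) _ (gh' X)) //;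
      apply: vderiv_smooth.
  - move=> a g h sg sh.
    have sa := smooth_at_cst p a; have sag := smooth_atM sa sg.
    have E Z : vsmooth_at p Z -> \forall q \near p,
        a * vderiv Z g q + vderiv Z h q = vderiv Z (fun q => a * g q + h q) q.
      move=> _.
      apply: filterS2 (smooth_at_near sg) (smooth_at_near sh) => q sgq shq.
      by rewrite /vderiv (derivation_linear (tangentP _)).
    have sE Z : vsmooth_at p Z ->
        smooth_at p (fun q => a * vderiv Z g q + vderiv Z h q).
      move=> sZ; apply: smooth_atD; last exact: vderiv_smooth.
      by apply: smooth_atM => //; apply: vderiv_smooth.
    rewrite !bE //; last exact: smooth_atD.
    rewrite -(tangent_near (X p) (sE _ sY) (E _ sY)).
    rewrite -(tangent_near (Y p) (sE _ sX) (E _ sX)).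
    by rewrite !(derivation_linear (tangentP _)); first ring;
      apply: vderiv_smooth.
  - move=> g h sg sh.
    have E Z : \forall q \near p,
        vderiv Z g q * h q + g q * vderiv Z h q
        = vderiv Z (fun q => g q * h q) q.
      apply: filterS2 (smooth_at_near sg) (smooth_at_near sh) => q sgq shq.
      by rewrite /vderiv tangent_fM.
    have sgZ Z : vsmooth_at p Z -> smooth_at p (vderiv Z g).
      by move=> sZ; apply: vderiv_smooth.
    have shZ Z : vsmooth_at p Z -> smooth_at p (vderiv Z h).
      by move=> sZ; apply: vderiv_smooth.
    have s1 Z : vsmooth_at p Z -> smooth_at p (fun q => vderiv Z g q * h q).
      by move=> sZ; apply: smooth_atM => //; apply: sgZ.
    have s2 Z : vsmooth_at p Z -> smooth_at p (fun q => g q * vderiv Z h q).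
      by move=> sZ; apply: smooth_atM => //; apply: shZ.
    have sE Z : vsmooth_at p Z ->
        smooth_at p (fun q => vderiv Z g q * h q + g q * vderiv Z h q).
      by move=> sZ; apply: smooth_atD; [apply: s1|apply: s2].
    rewrite !bE //; last exact: smooth_atM.
    rewrite -(tangent_near (X p) (sE _ sY) (E _)).
    rewrite -(tangent_near (Y p) (sE _ sX) (E _)).
    rewrite !tangent_fD ?tangent_fM //;
      try by [exact: s1|exact: s2|exact: sgZ|exact: shZ].
    by rewrite /vderiv; ring.
  - by move=> g ng; rewrite /b; case: asboolP.
by rewrite insubdK ?bE.
Qed.

(** Each double bracket expands into four third-order derivatives of a test function, and the twelve
    terms cancel in pairs. *)
Lemma jacobi p X Y Z :
  vsmooth_at p X -> vsmooth_at p Y -> vsmooth_at p Z ->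
  vsmooth_at p (lie_bracket X Y) -> vsmooth_at p (lie_bracket Y Z) ->
  vsmooth_at p (lie_bracket Z X) ->
  lie_bracket (lie_bracket X Y) Z p + lie_bracket (lie_bracket Y Z) X p
  + lie_bracket (lie_bracket Z X) Y p = 0.
Proof.
move=> sX sY sZ sXY sYZ sZX; apply: tangent_eq => f sf.
have E V W : vsmooth_at p V -> vsmooth_at p W -> \forall q \near p,
    vderiv V (vderiv W f) q - vderiv W (vderiv V f) q
    = vderiv (lie_bracket V W) f q.
  move=> sV sW; apply: filterS3 (vsmooth_at_near sV) (vsmooth_at_near sW)
    (smooth_at_near sf) => q sVq sWq sfq.
  by rewrite /vderiv lie_bracketE.
have sd V W : vsmooth_at p V -> vsmooth_at p W ->
    smooth_at p (vderiv V (vderiv W f)).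
  by move=> sV sW; apply: vderiv_smooth => //; apply: vderiv_smooth.
have sb V W : vsmooth_at p V -> vsmooth_at p W ->
    smooth_at p (fun q => vderiv V (vderiv W f) q - vderiv W (vderiv V f) q).
  by move=> sV sW; apply: smooth_atB; apply: sd.
have bb V W U : vsmooth_at p V -> vsmooth_at p W -> vsmooth_at p U ->
    vsmooth_at p (lie_bracket V W) ->
    lie_bracket (lie_bracket V W) U p f =
    V p (vderiv W (vderiv U f)) - W p (vderiv V (vderiv U f))
    - (U p (vderiv V (vderiv W f)) - U p (vderiv W (vderiv V f))).
  move=> sV sW sU sVW; rewrite lie_bracketE // lie_bracketE //; last first.
    exact: vderiv_smooth.
  rewrite -(tangent_near (U p) (sb _ _ sV sW) (E _ _ sV sW)).
  by rewrite tangent_fB //; apply: sd.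
by rewrite !tangentD !bb // tangent0; ring.
Qed.

End Fields.

(** * Traces of endomorphisms *)

Section Trace.
Context {K : fieldType} {V : lmodType K}.

Lemma basis_inj (m : nat) (b : 'I_m -> V) (x y : 'I_m -> K) : is_basis b ->
  \sum_i x i *: b i = \sum_i y i *: b i -> x =1 y.
Proof.
move=> /(_ (\sum_i x i *: b i))[r [_ ru]] xy i.
have rx : r = \row_i x i by apply: ru; apply: eq_bigr => j _; rewrite mxE.
have ry : r = \row_i y i.
  by apply: ru; rewrite xy; apply: eq_bigr => j _; rewrite mxE.
by have /rowP/(_ i) := etrans (esym rx) ry; rewrite !mxE.
Qed.

Lemma basis_coord (m m' : nat) (b : 'I_m -> V) (v : 'I_m' -> V) : is_basis b ->
  exists P : 'M[K]_(m, m'), forall j, v j = \sum_i P i j *: b i.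
Proof.
move=> bb.
have /choice[r rv] : forall j, exists r : 'rV[K]_m, v j = \sum_i r 0 i *: b i.
  by move=> j; have [r [rv _]] := bb (v j); exists r.
exists (\matrix_(i, j) r j 0 i) => j; rewrite rv.
by apply: eq_bigr => i _; rewrite mxE.
Qed.

Lemma mulmx_comb (m m' k : nat) (b : 'I_m -> V) (B : 'M[K]_(m, m'))
    (C : 'M[K]_(m', k)) j :
  \sum_i C i j *: (\sum_l B l i *: b l) = \sum_l (B *m C) l j *: b l.
Proof.
under eq_bigr do rewrite scaler_sumr.
rewrite exchange_big; apply: eq_bigr => l _; rewrite mxE scaler_suml.
by apply: eq_bigr => i _; rewrite scalerA mulrC.
Qed.

Lemma basis_change1 (m m' : nat) (b : 'I_m -> V) (b' : 'I_m' -> V)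
    (P : 'M[K]_(m, m')) (Q : 'M[K]_(m', m)) : is_basis b ->
  (forall j, b' j = \sum_i P i j *: b i) ->
  (forall j, b j = \sum_i Q i j *: b' i) -> P *m Q = 1%:M.
Proof.
move=> bb b'E bE; apply/matrixP => k j.
have := bE j; under eq_bigr do rewrite b'E.
rewrite mulmx_comb => e; apply/esym; rewrite mxE.
have : \sum_i (i == j)%:R *: b i = \sum_l (P *m Q) l j *: b l.
  rewrite -e (bigD1 j) //= eqxx scale1r big1 ?addr0 // => i /negbTE ->.
  by rewrite scale0r.
by move/(basis_inj bb)/(_ k).
Qed.

(** A second basis may a priori have another size. The change of basis matrices [P] and [Q] are
    rectangular with P Q = 1 and Q P = 1, and P A' = A P gives tr A' = tr (Q A P) = tr (P Q A) = tr
    A without comparing the sizes. *)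
Lemma endo_trace_basis (L : V -> V) (m : nat) (b : 'I_m -> V) (A : 'M[K]_m) :
  linear L -> is_basis b -> (forall j, L (b j) = \sum_i A i j *: b i) ->
  endo_trace L = \tr A.
Proof.
move=> linL bb LA; apply: xget_unique; first by exists m, b, A.
move=> _ [m' [b' [A' [bb' LA' ->]]]].
have L0 : L 0 = 0.
  by have := linL (-1) 0 0; rewrite scaleN1r oppr0 add0r scaleN1r addNr.
have Lsum (I : finType) (c : I -> K) (v : I -> V) :
    L (\sum_i c i *: v i) = \sum_i c i *: L (v i).
  by elim/big_rec2: _ => // i x y _ <-; rewrite linL.
have [P PE] := basis_coord b' bb; have [Q QE] := basis_coord b bb'.
have PQ := basis_change1 bb PE QE; have QP := basis_change1 bb' QE PE.
have AP : P *m A' = A *m P.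
  apply/matrixP => k j; have := LA' j; rewrite {1}PE Lsum.
  under eq_bigr do rewrite LA.
  under [in RHS]eq_bigr do rewrite PE.
  by rewrite !mulmx_comb => /(basis_inj bb)/(_ k) ->.
by rewrite -[A']mul1mx -QP -mulmxA AP mulmxA mxtrace_mulC mulmxA PQ mul1mx.
Qed.

End Trace.

(** * Tensoriality of the curvature *)

(** A field is a dependent function; this form of extensionality lets [under] rewrite below its
    binder. *)
Lemma eq_vfield {R : realType} {n : nat} {M : manifold R n} (X Y : vfield M) :
  (forall q, X q = Y q) -> (fun q => X q) = (fun q => Y q).
Proof. exact: functional_extensionality_dep. Qed.

Lemma vsmooth_at_sum {R : realType} {n : nat} {M : manifold R n} (p : M)
    (I : Type) (r : seq I) (f : I -> M -> R) (X : I -> vfield M) :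
  (forall i, smooth_at p (f i)) -> (forall i, vsmooth_at p (X i)) ->
  vsmooth_at p (fun q => \sum_(i <- r) f i q *: X i q).
Proof.
move=> sf sX; elim: r => [|i r IH].
  by under eq_vfield do rewrite big_nil; apply: vsmooth_at0.
by under eq_vfield do rewrite big_cons; apply: vsmooth_atZD.
Qed.

Section Connection.
Context {R : realType} {n : nat} {M : manifold R n}.
Context {g : tensor02 M} {nabla : vfield M -> vfield M -> vfield M}.
Context (gP : riemannian_metric g) (lc : levi_civita g nabla).
Implicit Types (f : M -> R) (p : M) (X Y Z : vfield M).

Lemma metricDl p (x y z : tangent p) : g (x + y) z = g x z + g y z.
Proof.
rewrite !(Defs.metric_sym gP _ z); have := metric_linear gP z 1 x y.
by rewrite !scale1r /= mul1r.
Qed.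

Lemma metric0r p (x : tangent p) : g x 0 = 0.
Proof.
have := metric_linear gP x (-1) 0 0.
by rewrite scaleN1r oppr0 add0r /= mulN1r addNr.
Qed.

Lemma metricZr p (a : R) (x y : tangent p) : g x (a *: y) = a * g x y.
Proof. by have := metric_linear gP x a y 0; rewrite metric0r !addr0. Qed.

Lemma metricDr p (x y z : tangent p) : g z (x + y) = g z x + g z y.
Proof. by rewrite !(Defs.metric_sym gP z) metricDl. Qed.

Lemma metricZl p (a : R) (x y : tangent p) : g (a *: x) y = a * g x y.
Proof. by rewrite !(Defs.metric_sym gP _ y) metricZr. Qed.

Lemma metricNl p (x y : tangent p) : g (- x) y = - g x y.
Proof. by rewrite -scaleN1r metricZl mulN1r. Qed.

Lemma metricNr p (x y : tangent p) : g x (- y) = - g x y.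
Proof. by rewrite -scaleN1r metricZr mulN1r. Qed.

Lemma metric_sumr p (x : tangent p) (I : Type) (r : seq I) (c : I -> R)
    (v : I -> tangent p) :
  g x (\sum_(i <- r) c i *: v i) = \sum_(i <- r) c i * g x (v i).
Proof.
elim: r => [|i r IH]; first by rewrite !big_nil metric0r.
by rewrite !big_cons metricDr metricZr IH.
Qed.

Lemma nabla_near_l p X X' Y : vsmooth_at p X -> vsmooth_at p Y ->
  (\forall q \near p, X q = X' q) -> nabla X Y p = nabla X' Y p.
Proof. by move=> sX sY XX'; apply: (lc_local lc sX sY XX'); apply: nearW. Qed.

Lemma nabla_near_r p X Y Y' : vsmooth_at p X -> vsmooth_at p Y ->
  (\forall q \near p, Y q = Y' q) -> nabla X Y p = nabla X Y' p.
Proof. by move=> sX sY YY'; apply: (lc_local lc sX sY); first apply: nearW. Qed.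

(** The axiom combines scaling and addition. With the constant -1 and zero fields the combined field
    is again zero, and the axiom reads N = - N + N. The other zero lemmas rest on the same
    choice. *)
Lemma nabla0l p X : vsmooth_at p X -> nabla (fun=> 0) X p = 0.
Proof.
move=> sX; have s0 := @vsmooth_at0 _ _ _ p.
have := lc_tensorial lc (smooth_at_cst p (-1)) s0 s0 sX.
by under eq_vfield do rewrite scaler0 addr0; rewrite scaleN1r addNr.
Qed.

Lemma nabla0r p X : vsmooth_at p X -> nabla X (fun=> 0) p = 0.
Proof.
move=> sX; have s0 := @vsmooth_at0 _ _ _ p.
have := lc_leibniz lc (smooth_at_cst p (-1)) sX s0 s0.
under eq_vfield do rewrite scaler0 addr0.
by rewrite scaler0 add0r scaleN1r addNr.
Qed.

Lemma nablaZl p f X Y : smooth_at p f -> vsmooth_at p X -> vsmooth_at p Y ->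
  nabla (fun q => f q *: X q) Y p = f p *: nabla X Y p.
Proof.
move=> sf sX sY; have := lc_tensorial lc sf sX (@vsmooth_at0 _ _ _ p) sY.
by under eq_vfield do rewrite addr0; rewrite nabla0l // addr0.
Qed.

Lemma nablaDl p X X' Y : vsmooth_at p X -> vsmooth_at p X' -> vsmooth_at p Y ->
  nabla (fun q => X q + X' q) Y p = nabla X Y p + nabla X' Y p.
Proof.
move=> sX sX' sY; have := lc_tensorial lc (smooth_at_cst p 1) sX sX' sY.
by under eq_vfield do rewrite scale1r; rewrite scale1r.
Qed.

Lemma nablaZr p f X Y : smooth_at p f -> vsmooth_at p X -> vsmooth_at p Y ->
  nabla X (fun q => f q *: Y q) p = vderiv X f p *: Y p + f p *: nabla X Y p.
Proof.
move=> sf sX sY; have := lc_leibniz lc sf sX sY (@vsmooth_at0 _ _ _ p).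
by under eq_vfield do rewrite addr0; rewrite nabla0r // addr0.
Qed.

Lemma nablaDr p X Y Y' : vsmooth_at p X -> vsmooth_at p Y -> vsmooth_at p Y' ->
  nabla X (fun q => Y q + Y' q) p = nabla X Y p + nabla X Y' p.
Proof.
move=> sX sY sY'; have := lc_leibniz lc (smooth_at_cst p 1) sX sY sY'.
under eq_vfield do rewrite scale1r.
by rewrite /vderiv tangent_cst scale0r add0r scale1r.
Qed.

Lemma nablaNr p X Y : vsmooth_at p X -> vsmooth_at p Y ->
  nabla X (fun q => - Y q) p = - nabla X Y p.
Proof.
move=> sX sY; under eq_vfield do rewrite -scaleN1r.
rewrite (nablaZr (smooth_at_cst p (-1))) //.
by rewrite /vderiv tangent_cst scale0r add0r scaleN1r.
Qed.

Lemma nablaNl p X Y : vsmooth_at p X -> vsmooth_at p Y ->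
  nabla (fun q => - X q) Y p = - nabla X Y p.
Proof.
move=> sX sY; under eq_vfield do rewrite -scaleN1r.
by rewrite (nablaZl (smooth_at_cst p (-1))) // scaleN1r.
Qed.

Lemma nabla_suml p (I : Type) (r : seq I) (f : I -> M -> R)
    (X : I -> vfield M) Y :
  (forall i, smooth_at p (f i)) -> (forall i, vsmooth_at p (X i)) ->
  vsmooth_at p Y ->
  nabla (fun q => \sum_(i <- r) f i q *: X i q) Y p
  = \sum_(i <- r) f i p *: nabla (X i) Y p.
Proof.
move=> sf sX sY; elim: r => [|i r IH].
  by under eq_vfield do rewrite big_nil; rewrite nabla0l // big_nil.
under eq_vfield do rewrite big_cons; rewrite big_cons -IH.
by rewrite (lc_tensorial lc) //; apply: vsmooth_at_sum.
Qed.

Lemma nabla_sumr p (I : Type) (r : seq I) X (f : I -> M -> R)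
    (Y : I -> vfield M) :
  (forall i, smooth_at p (f i)) -> (forall i, vsmooth_at p (Y i)) ->
  vsmooth_at p X ->
  nabla X (fun q => \sum_(i <- r) f i q *: Y i q) p
  = \sum_(i <- r) (X p (f i) *: Y i p + f i p *: nabla X (Y i) p).
Proof.
move=> sf sY sX; elim: r => [|i r IH].
  by under eq_vfield do rewrite big_nil; rewrite nabla0r // big_nil.
under eq_vfield do rewrite big_cons; rewrite big_cons -IH.
by rewrite (lc_leibniz lc) //; apply: vsmooth_at_sum.
Qed.

Lemma bracket_near p X Y : vsmooth_at p X -> vsmooth_at p Y ->
  \forall q \near p, nabla X Y q - nabla Y X q = lie_bracket X Y q.
Proof.
move=> sX sY; apply: filterS2 (vsmooth_at_near sX) (vsmooth_at_near sY) => q.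
exact: (lc_torsion_free lc).
Qed.

(** Near [p] the bracket is a difference of two covariant derivatives, which [lc_smooth] makes
    smooth. *)
Lemma vsmooth_bracket p X Y : vsmooth_at p X -> vsmooth_at p Y ->
  vsmooth_at p (lie_bracket X Y).
Proof.
move=> sX sY; apply: vsmooth_at_eq (bracket_near sX sY) _.
by apply: vsmooth_atB; apply: (lc_smooth lc).
Qed.

Lemma nabla_bracket p X Y Z :
  vsmooth_at p X -> vsmooth_at p Y -> vsmooth_at p Z ->
  nabla (lie_bracket X Y) Z p = nabla (nabla X Y) Z p - nabla (nabla Y X) Z p.
Proof.
move=> sX sY sZ; have sXY := lc_smooth lc sX sY; have sYX := lc_smooth lc sY sX.
rewrite -(nabla_near_l (vsmooth_atB sXY sYX) sZ (bracket_near sX sY)).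
by rewrite nablaDl ?nablaNl //; apply: vsmooth_atN.
Qed.

(** Torsion-freeness trades the bracket for covariant derivatives, so that tensoriality becomes a
    computation with the axioms of [nabla] alone. *)
Lemma curvatureE p X Y Z : vsmooth_at p X -> vsmooth_at p Y -> vsmooth_at p Z ->
  curvature nabla X Y Z p = nabla X (nabla Y Z) p - nabla Y (nabla X Z) p
    - (nabla (nabla X Y) Z p - nabla (nabla Y X) Z p).
Proof. by move=> sX sY sZ; rewrite /curvature nabla_bracket. Qed.

Lemma curvatureC p X Y Z : vsmooth_at p X -> vsmooth_at p Y -> vsmooth_at p Z ->
  curvature nabla X Y Z p = - curvature nabla Y X Z p.
Proof.
move=> sX sY sZ; rewrite !curvatureE //; apply: tangent_eq => h _.
by rewrite !(tangentD, tangentN); ring.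
Qed.

Lemma nabla_near_near_l p X X' Y : vsmooth_at p X -> vsmooth_at p Y ->
  (\forall q \near p, X q = X' q) ->
  \forall q \near p, nabla X Y q = nabla X' Y q.
Proof.
move=> sX sY /near_join XX'.
apply: filterS3 (vsmooth_at_near sX) (vsmooth_at_near sY) XX' => q.
exact: nabla_near_l.
Qed.

Lemma nabla_near_near_r p X Y Y' : vsmooth_at p X -> vsmooth_at p Y ->
  (\forall q \near p, Y q = Y' q) ->
  \forall q \near p, nabla X Y q = nabla X Y' q.
Proof.
move=> sX sY /near_join YY'.
apply: filterS3 (vsmooth_at_near sX) (vsmooth_at_near sY) YY' => q.
exact: nabla_near_r.
Qed.

Lemma curvature_near p X X' Y Z :
  vsmooth_at p X -> vsmooth_at p Y -> vsmooth_at p Z ->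
  (\forall q \near p, X q = X' q) ->
  curvature nabla X Y Z p = curvature nabla X' Y Z p.
Proof.
move=> sX sY sZ XX'; have sX' := vsmooth_at_eq XX' sX.
have s := lc_smooth lc.
rewrite !curvatureE // (nabla_near_l _ _ XX') //; last exact: s.
rewrite (nabla_near_r _ _ (nabla_near_near_l sX sZ XX')) //; last exact: s.
rewrite (nabla_near_l _ _ (nabla_near_near_l sX sY XX')) //; last exact: s.
by rewrite (nabla_near_l _ _ (nabla_near_near_r sY sX XX')) //; exact: s.
Qed.

(** The derivative Y(f) occurs twice, in nabla_Y (f nabla_X Z) and in the derivative of Z along
    nabla_Y (f X); both give Y(f) nabla_X Z, with opposite signs. *)
Lemma curvatureZDl p f X X' Y Z : smooth_at p f -> vsmooth_at p X ->
  vsmooth_at p X' -> vsmooth_at p Y -> vsmooth_at p Z ->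
  curvature nabla (fun q => f q *: X q + X' q) Y Z p
  = f p *: curvature nabla X Y Z p + curvature nabla X' Y Z p.
Proof.
move=> sf sX sX' sY sZ; have s := lc_smooth lc.
have sfX := vsmooth_atZD sf sX sX'.
rewrite !curvatureE // (lc_tensorial lc) //; last exact: s.
have E W : vsmooth_at p W -> \forall q \near p,
    f q *: nabla X W q + nabla X' W q = nabla (fun q => f q *: X q + X' q) W q.
  move=> sW; apply: filterS3 (filterI (smooth_at_near sf) (vsmooth_at_near sW))
    (vsmooth_at_near sX) (vsmooth_at_near sX') => q [? ?] ? ?.
  by rewrite (lc_tensorial lc).
have F : \forall q \near p,
    vderiv Y f q *: X q + (f q *: nabla Y X q + nabla Y X' q)
    = nabla Y (fun q => f q *: X q + X' q) q.
  apply: filterS3 (filterI (smooth_at_near sf) (vsmooth_at_near sY))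
    (vsmooth_at_near sX) (vsmooth_at_near sX') => q [? ?] ? ?.
  by rewrite (lc_leibniz lc) // addrA.
have sYf : smooth_at p (vderiv Y f) by apply: vderiv_smooth.
have sE W : vsmooth_at p W ->
    vsmooth_at p (fun q => f q *: nabla X W q + nabla X' W q).
  by move=> sW; apply: vsmooth_atZD => //; apply: s.
rewrite -(nabla_near_r _ _ (E _ sZ)) //; last exact: sE.
rewrite -(nabla_near_l _ _ (E _ sY)) //; last exact: sE.
rewrite -(nabla_near_l _ _ F) //; last first.
  by apply: vsmooth_atZD => //; apply: vsmooth_atZD => //; apply: s.
rewrite (lc_leibniz lc) //; try exact: s.
rewrite !(lc_tensorial lc) //; try exact: s; last first.
  by apply: vsmooth_atZD => //; apply: s.
apply: tangent_eq => h _.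
by rewrite !(tangentD, tangentN, tangentZ); ring.
Qed.

Lemma curvature0l p Y Z : vsmooth_at p Y -> vsmooth_at p Z ->
  curvature nabla (fun=> 0) Y Z p = 0.
Proof.
move=> sY sZ; have s0 := @vsmooth_at0 _ _ _ p.
have := curvatureZDl (smooth_at_cst p (-1)) s0 s0 sY sZ.
by under eq_vfield do rewrite scaler0 addr0; rewrite scaleN1r addNr.
Qed.

Lemma curvatureZl p f X Y Z : smooth_at p f -> vsmooth_at p X ->
  vsmooth_at p Y -> vsmooth_at p Z ->
  curvature nabla (fun q => f q *: X q) Y Z p = f p *: curvature nabla X Y Z p.
Proof.
move=> sf sX sY sZ; have := curvatureZDl sf sX (@vsmooth_at0 _ _ _ p) sY sZ.
by under eq_vfield do rewrite addr0; rewrite curvature0l // addr0.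
Qed.

Lemma curvature_suml p (I : Type) (r : seq I) (f : I -> M -> R)
    (X : I -> vfield M) Y Z :
  (forall i, smooth_at p (f i)) -> (forall i, vsmooth_at p (X i)) ->
  vsmooth_at p Y -> vsmooth_at p Z ->
  curvature nabla (fun q => \sum_(i <- r) f i q *: X i q) Y Z p
  = \sum_(i <- r) f i p *: curvature nabla (X i) Y Z p.
Proof.
move=> sf sX sY sZ; elim: r => [|i r IH].
  by under eq_vfield do rewrite big_nil; rewrite curvature0l // big_nil.
under eq_vfield do rewrite big_cons; rewrite big_cons -IH.
by rewrite curvatureZDl //; apply: vsmooth_at_sum.
Qed.

Lemma curvatureZm p f X Y Z : smooth_at p f -> vsmooth_at p X ->
  vsmooth_at p Y -> vsmooth_at p Z ->
  curvature nabla X (fun q => f q *: Y q) Z p = f p *: curvature nabla X Y Z p.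
Proof.
move=> sf sX sY sZ; rewrite curvatureC ?curvatureZl //; last exact: vsmooth_atZ.
by rewrite (curvatureC sY) // scalerN opprK.
Qed.

Lemma curvature_scaler p (a : R) X Y Z : vsmooth_at p X ->
  vsmooth_at p Y -> vsmooth_at p Z ->
  curvature nabla X Y (fun q => a *: Z q) p = a *: curvature nabla X Y Z p.
Proof.
move=> sX sY sZ; have s := lc_smooth lc.
have sa (q : M) : smooth_at q (fun=> a : R) := smooth_at_cst q a.
have C q W V : vsmooth_at q W -> vsmooth_at q V ->
    a *: nabla W V q = nabla W (fun q => a *: V q) q.
  move=> sW sV.
  by rewrite (nablaZr (sa q)) // /vderiv tangent_cst scale0r add0r.
have E W : vsmooth_at p W -> \forall q \near p,
    a *: nabla W Z q = nabla W (fun q => a *: Z q) q.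
  move=> sW; apply: filterS2 (vsmooth_at_near sW) (vsmooth_at_near sZ) => q.
  exact: C.
have saZ := vsmooth_atZ (sa p) sZ.
have sanZ W : vsmooth_at p W -> vsmooth_at p (fun q => a *: nabla W Z q).
  by move=> sW; apply: vsmooth_atZ (sa p) (s _ _ _ sW sZ).
rewrite !curvatureE // -(nabla_near_r _ _ (E _ sY)) //; last exact: sanZ.
rewrite -(nabla_near_r _ _ (E _ sX)) //; last exact: sanZ.
by rewrite -!C ?scalerBr //; apply: s.
Qed.

End Connection.

(** * Orthonormal frames *)

Section Frame.
Context {R : realType} {n : nat} {M : manifold R n}.
Context {g : tensor02 M} {nabla : vfield M -> vfield M -> vfield M}.
Context (gP : riemannian_metric g) (lc : levi_civita g nabla).
Context {m : nat} {E : 'I_m -> vfield M} {U : set M}.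
Context (oU : open U) (sE : forall p i, U p -> vsmooth_at p (E i)).
Context (bE : forall p, U p -> is_basis (fun i => E i p)).
Context (orthE : forall p i j, U p -> g (E i p) (E j p) = (i == j)%:R).
Implicit Types (f : M -> R) (p : M) (X Y Z : vfield M) (i j k l : 'I_m).

Lemma frame_coord p (c : 'I_m -> R) k : U p ->
  g (\sum_i c i *: E i p) (E k p) = c k.
Proof.
move=> Up; rewrite (Defs.metric_sym gP) (metric_sumr gP) (bigD1 k) //=.
rewrite orthE // eqxx mulr1 big1 ?addr0 // => i ik.
by rewrite orthE // eq_sym (negbTE ik) mulr0.
Qed.

Lemma frame_expand p (v : tangent p) : U p ->
  v = \sum_i g v (E i p) *: E i p.
Proof.
move=> Up; have [c [vc _]] := bE Up v; rewrite {1}vc.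
by apply: eq_bigr => i _; rewrite vc (frame_coord (fun i => c 0 i)).
Qed.

Lemma frame_expand_near p X : U p ->
  \forall q \near p, X q = \sum_i g (X q) (E i q) *: E i q.
Proof. by move=> Up; apply: (open_near oU Up) => q; apply: frame_expand. Qed.

(** The combination of the frame with constant coefficients is one extension of [x]. Any other is,
    near [p], a combination with smooth coefficients, and by tensoriality only their values at [p]
    count. *)
Lemma curvature_opE p Y Z (x : tangent p) : U p ->
  vsmooth_at p Y -> vsmooth_at p Z ->
  curvature_op nabla Y Z x
  = \sum_i g x (E i p) *: curvature nabla (E i) Y Z p.
Proof.
move=> Up sY sZ; apply: xget_unique.
  exists (fun q => \sum_i g x (E i p) *: E i q); split.
  - by apply: vsmooth_at_sum => i; [apply: smooth_at_cst|apply: sE].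
  - by rewrite -frame_expand.
  - by rewrite (curvature_suml lc) // => i; [apply: smooth_at_cst|apply: sE].
move=> _ [X [sX Xp ->]].
have sXE i : smooth_at p (fun q => g (X q) (E i q)).
  by apply: (metric_smooth gP) => //; apply: sE.
rewrite (curvature_near lc sX sY sZ (frame_expand_near X Up)).
rewrite (curvature_suml lc) // => [|i]; last exact: sE.
by apply: eq_bigr => i _; rewrite Xp.
Qed.

Lemma ricciE p Y Z : U p -> vsmooth_at p Y -> vsmooth_at p Z ->
  ricci nabla Y Z p = \sum_i g (curvature nabla (E i) Y Z p) (E i p).
Proof.
move=> Up sY sZ.
pose A : 'M[R]_m := \matrix_(i, j) g (curvature nabla (E j) Y Z p) (E i p).
rewrite /ricci (@endo_trace_basis _ _ _ _ (fun i => E i p) A) //; last 2 first.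
- exact: bE.
- move=> j; rewrite curvature_opE // (bigD1 j) //= orthE // eqxx scale1r.
  rewrite big1 ?addr0 => [|i ij]; last first.
    by rewrite orthE // eq_sym (negbTE ij) scale0r.
  by rewrite [LHS]frame_expand //; apply: eq_bigr => i _; rewrite mxE.
- by apply: eq_bigr => i _; rewrite mxE.
move=> a x y; rewrite !curvature_opE // scaler_sumr -big_split /=.
apply: eq_bigr => i _.
by rewrite (metricDl gP) (metricZl gP) scalerDl scalerA.
Qed.

Lemma ricciZZ p (a b : R) Y Z : U p -> vsmooth_at p Y -> vsmooth_at p Z ->
  ricci nabla (fun q => a *: Y q) (fun q => b *: Z q) p
  = a * b * ricci nabla Y Z p.
Proof.
move=> Up sY sZ; have sa := smooth_at_cst p a; have sb := smooth_at_cst p b.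
have sbZ := vsmooth_atZ sb sZ.
rewrite !ricciE ?mulr_sumr //; last exact: vsmooth_atZ sa sY.
apply: eq_bigr => i _; have sEi := sE i Up.
rewrite (curvatureZm lc sa) // (curvature_scaler lc) //.
by rewrite !(metricZl gP) mulrA.
Qed.

Definition christoffel i j k : M -> R :=
  fun q => g (nabla (E i) (E j) q) (E k q).

Local Notation G := christoffel.

Lemma christoffel_smooth p i j k : U p -> smooth_at p (G i j k).
Proof.
move=> Up; apply: (metric_smooth gP); last exact: sE.
by apply: (lc_smooth lc); apply: sE.
Qed.

Lemma nabla_frame p i j : U p ->
  nabla (E i) (E j) p = \sum_k G i j k p *: E k p.
Proof. exact: frame_expand. Qed.

(** Metric compatibility applied to g(E_j, E_k), which is constant near [p]. *)
Lemma christoffel_skew p i j k : U p -> G i j k p = - G i k j p.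
Proof.
move=> Up; apply/eqP.
rewrite -addr_eq0 /G (Defs.metric_sym gP (nabla _ (E k) p)).
have := lc_metric lc (sE j Up) (sE k Up) (sE i Up).
rewrite /vderiv -(tangent_near _ (smooth_at_cst p ((j == k)%:R : R))).
  by rewrite tangent_cst => <-.
by apply: (open_near oU Up) => q Uq; rewrite orthE.
Qed.

Lemma nabla_comb p i (f : 'I_m -> M -> R) :
  U p -> (forall j, smooth_at p (f j)) ->
  nabla (E i) (fun q => \sum_j f j q *: E j q) p
  = \sum_l (E i p (f l) + \sum_j f j p * G i j l p) *: E l p.
Proof.
move=> Up sf; rewrite (nabla_sumr lc) //;
  try by [exact: sE|move=> j; exact: sE].
rewrite big_split /=; under [RHS]eq_bigr do rewrite scalerDl.
rewrite big_split /=; congr (_ + _).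
under eq_bigr do rewrite nabla_frame // scaler_sumr.
rewrite exchange_big; apply: eq_bigr => l _; rewrite scaler_suml.
by apply: eq_bigr => j _; rewrite scalerA.
Qed.

Lemma nabla_nabla_frame p i j k l : U p ->
  g (nabla (E i) (nabla (E j) (E k)) p) (E l p)
  = E i p (G j k l) + \sum_r G j k r p * G i r l p.
Proof.
move=> Up; rewrite (nabla_near_r lc _ _ (frame_expand_near _ Up)).
- by rewrite nabla_comb ?frame_coord // => r; apply: christoffel_smooth.
- exact: sE.
- by apply: (lc_smooth lc); apply: sE.
Qed.

Lemma nabla_frame_nabla p i j k l : U p ->
  g (nabla (nabla (E i) (E j)) (E k) p) (E l p)
  = \sum_r G i j r p * G r k l p.
Proof.
move=> Up; rewrite (nabla_near_l lc _ _ (frame_expand_near _ Up)).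
- rewrite (nabla_suml lc); first last.
  + exact: sE.
  + by move=> r; apply: sE.
  + by move=> r; apply: christoffel_smooth.
  under [X in g X _]eq_bigr => r _ do rewrite (nabla_frame r) // scaler_sumr.
  rewrite exchange_big /=.
  under [X in g X _]eq_bigr => s _ do
    (under eq_bigr do rewrite scalerA; rewrite -scaler_suml).
  by rewrite (frame_coord (fun l => \sum_r G i j r p * G r k l p)).
- by apply: (lc_smooth lc); apply: sE.
- exact: sE.
Qed.

(** The frame fields do not commute: [G i j r - G j i r] is the component of [E_i, E_j] along E_r,
    which accounts for the last product. *)
Lemma curvature_frame p i j k l : U p ->
  g (curvature nabla (E i) (E j) (E k) p) (E l p)
  = E i p (G j k l) - E j p (G i k l)
    + \sum_r (G j k r p * G i r l p - G i k r p * G j r l p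
              - (G i j r p - G j i r p) * G r k l p).
Proof.
move=> Up; rewrite (curvatureE lc); try exact: sE.
rewrite !(metricDl gP, metricNl gP, nabla_nabla_frame, nabla_frame_nabla) //.
rewrite !sumrB.
under [X in _ = _ + (_ - X)]eq_bigr do rewrite mulrBl.
by rewrite sumrB; ring.
Qed.

Lemma ricci_frame p j k : U p ->
  ricci nabla (E j) (E k) p
  = \sum_i (E i p (G j k i) - E j p (G i k i)
      + \sum_r (G j k r p * G i r i p - G i k r p * G j r i p
                - (G i j r p - G j i r p) * G r k i p)).
Proof.
move=> Up; rewrite ricciE //; try exact: sE.
by apply: eq_bigr => i _; rewrite curvature_frame.
Qed.

(** [J i j k] is the E_l-component of [[E_i, E_j], E_k]: with V = [E_i, E_j], it is read off from
    nabla_V E_k - nabla_{E_k} V. *)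
Lemma jacobi_frame p i j k l : U p ->
  let J i j k := \sum_r (G i j r p - G j i r p) * (G r k l p - G k r l p)
                 - (E k p (G i j l) - E k p (G j i l)) in
  J i j k + J j k i + J k i j = 0.
Proof.
move=> Up J; have s i' : vsmooth_at p (E i') := sE i' Up.
have sb i' j' := vsmooth_bracket lc (s i') (s j').
have JE i' j' k' :
    g (lie_bracket (lie_bracket (E i') (E j')) (E k') p) (E l p) = J i' j' k'.
  rewrite -(lc_torsion_free lc) // (nabla_bracket lc) //.
  rewrite -(nabla_near_r lc _ _ (bracket_near lc (s i') (s j'))) //; last first.
    by apply: vsmooth_atB; apply: (lc_smooth lc).
  have sN i1 j1 : vsmooth_at p (nabla (E i1) (E j1)) by apply: (lc_smooth lc).
  rewrite (nablaDr lc) // ?(nablaNr lc) //; last exact: vsmooth_atN.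
  rewrite !(metricDl gP, metricNl gP, nabla_nabla_frame, nabla_frame_nabla) //.
  rewrite /J; under [in RHS]eq_bigr do rewrite mulrBr !mulrBl.
  by rewrite !sumrB; ring.
rewrite -!JE -!(metricDl gP) jacobi //.
by rewrite (Defs.metric_sym gP) (metric0r gP).
Qed.

End Frame.

(** * Trans-Sasakian manifolds *)

Section AlmostContact.
Context {R : realType} {n : nat} {M : manifold R n}.
Context (A : almost_contact_metric M).
Context {nabla : vfield M -> vfield M -> vfield M} {alpha beta : M -> R}.
Context (lc : levi_civita (metric A) nabla).
Context (tsA : trans_sasakian A nabla alpha beta).

Lemma smooth_on_setT (f : M -> R) p : smooth_on setT f -> smooth_at p f.
Proof. by move=> sf; exists setT => //; split=> //; apply: openT. Qed.

Lemma eta_metric p (x : tangent p) : eta A p x = metric A p x (xi A p).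
Proof.
have gP := metricP A; have := metric_phi A x (xi A p).
rewrite phi_xi eta_xi mulr1 (metric0r gP) => /esym/eqP.
by rewrite subr_eq0 => /eqP.
Qed.

(** Differentiate g(xi, xi) = 1. Since phi^2 is -1 on the kernel of eta, this makes nabla_X xi
    recoverable from its image under phi. *)
Lemma metric_nabla_xi p (X : vfield M) : vsmooth_at p X ->
  metric A p (nabla X (xi A) p) (xi A p) = 0.
Proof.
move=> sX; have gP := metricP A; have sxi := xi_smooth A p.
have := lc_metric lc sxi sxi sX.
rewrite (_ : (fun _ => _) = fun=> 1); last first.
  by apply/funext => q; rewrite -eta_metric eta_xi.
rewrite /vderiv tangent_cst (Defs.metric_sym gP (xi A p)) => /esym/eqP.
by rewrite -mulr2n mulrn_eq0 => /eqP.
Qed.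

(* Apply phi to the trans-Sasakian identity with Y = xi, where phi xi = 0. *)
Lemma nabla_xiE p (X : vfield M) : vsmooth_at p X ->
  nabla X (xi A) p = - alpha p *: phi A p (X p)
    + beta p *: (X p - eta A p (X p) *: xi A p).
Proof.
move=> sX; have [_ _ /(_ p X (xi A) sX (xi_smooth A p))] := tsA.
rewrite (_ : (fun q => _) = fun=> 0); last first.
  by apply: functional_extensionality_dep => q; rewrite phi_xi.
rewrite (nabla0r lc) // sub0r -!eta_metric eta_phi eta_xi.
rewrite scale0r sub0r !scale1r.
move=> e; have {e} := congr1 (fun v => phi A p v) e.
rewrite linearN linearD !linearZ linearN linearB linearZ /=.
rewrite phi_xi scaler0 sub0r !phi_phi.
rewrite eta_metric metric_nabla_xi // scale0r addr0 opprK => ->.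
by rewrite scaleNr scalerN opprD opprK scalerN.
Qed.

End AlmostContact.

(** * Connection, Jacobi identity and Ricci tensor in the frame (e1, e2, xi) *)

Section NPFrame.
Context {R : realType} {M : manifold R 3}.
Context (A : almost_contact_metric M).
Context {nabla : vfield M -> vfield M -> vfield M} {alpha beta : M -> R}.
Context (lc : levi_civita (metric A) nabla).
Context (tsA : trans_sasakian A nabla alpha beta).
Context {U : set M} {e1 e2 : vfield M} (npU : np_frame A U e1 e2).

Definition np_triple (i : 'I_3) : vfield M :=
  fun p => tnth [tuple e1 p; e2 p; xi A p] i.
Local Notation E := np_triple.
Local Notation i0 := (ord0 : 'I_3).
Local Notation i1 := (lift ord0 ord0 : 'I_3).
Local Notation i2 := (lift ord0 (lift ord0 ord0) : 'I_3).
Local Notation G := (@christoffel _ _ _ (metric A) nabla _ E).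

Lemma np_triple0 : E i0 = e1. Proof. by []. Qed.
Lemma np_triple1 : E i1 = e2. Proof. by []. Qed.
Lemma np_triple2 : E i2 = xi A. Proof. by []. Qed.

(** The indices take the shape that [big_ord_recl] produces, so that facts about them match the
    expanded sums. *)
Lemma ord3P (P : 'I_3 -> Prop) : P i0 -> P i1 -> P i2 -> forall i, P i.
Proof.
move=> P0 P1 P2; case=> [[|[|[|//]]] k].
- by rewrite (_ : Ordinal k = i0); last exact: val_inj.
- by rewrite (_ : Ordinal k = i1); last exact: val_inj.
- by rewrite (_ : Ordinal k = i2); last exact: val_inj.
Qed.

Lemma np_frame_smooth p i : U p -> vsmooth_at p (E i).
Proof.
move=> Up; have [s1 s2] := np_smooth npU Up.
by move: i; apply: ord3P => //; apply: xi_smooth.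
Qed.

Lemma np_triple_orth p i j : U p -> metric A p (E i p) (E j p) = (i == j)%:R.
Proof. by move=> Up; exact: np_orthonormal npU _ _ _ _. Qed.
Local Notation orthE := np_triple_orth.
Local Notation gP := (metricP A).
Local Notation oU := (np_open npU).
Local Notation bE := (np_basis npU).

Lemma phi_e2 p : U p -> phi A p (e2 p) = - e1 p.
Proof.
move=> Up; rewrite -(np_phi npU Up) phi_phi eta_metric.
by rewrite (np_triple_orth i0 i2 Up) scale0r addr0.
Qed.

(** The table of g(nabla_{E_i} E_j, E_k). Natural number indices let the match compute, and the
    entries are functions because the curvature differentiates them. *)
Definition np_christoffel (a b c : M -> R) (i j k : nat) : M -> R :=
  match i, j, k with
  | 0, 0, 1 => a | 0, 1, 0 => fun q => - a q
  | 1, 0, 1 => b | 1, 1, 0 => fun q => - b q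
  | 2, 0, 1 => c | 2, 1, 0 => fun q => - c q
  | 0, 2, 0 | 1, 2, 1 => beta
  | 0, 0, 2 | 1, 1, 2 => fun q => - beta q
  | 1, 2, 0 | 0, 1, 2 => alpha
  | 0, 2, 1 | 1, 0, 2 => fun q => - alpha q
  | _, _, _ => fun=> 0%R
  end%N.

Local Notation N := (np_christoffel (G i0 i0 i1) (G i1 i0 i1) (G i2 i0 i1)).

Lemma christoffel_xi p i k : U p -> G i i2 k p = N i 2 k p.
Proof.
move=> Up; have sEi := np_frame_smooth i Up.
rewrite [LHS]/christoffel (nabla_xiE lc tsA sEi) eta_metric.
rewrite (metricDl gP) !(metricZl gP) (metricDl gP) (metricNl gP) (metricZl gP).
have o := fun i j => orthE i j Up.
have p0 : phi A p (E i0 p) = E i1 p.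
  by rewrite np_triple0 np_triple1; exact: np_phi npU _ Up.
have p1 : phi A p (E i1 p) = - E i0 p by rewrite np_triple1; exact: phi_e2.
have p2 : phi A p (E i2 p) = 0 by rewrite np_triple2; exact: phi_xi.
rewrite -np_triple2 !o; clear sEi; move: i k.
apply: ord3P; apply: ord3P; rewrite ?p0 ?p1 ?p2 ?(metricNl gP) ?o;
  rewrite ?(Defs.metric_sym gP 0) ?(metric0r gP) /=; ring.
Qed.

(** The entries with [j] = 2 come from the formula for nabla xi; skewness in the last two indices
    gives the zero diagonal and the remaining mirror entries. *)
Lemma np_christoffelE p i j k : U p -> G i j k p = N i j k p.
Proof.
move=> Up; have skew i' j' k' :=
  christoffel_skew gP lc oU np_frame_smooth orthE i' j' k' Up.
have diag i' j' : G i' j' j' p = 0.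
  by have /eqP := skew i' j' j'; rewrite -addr_eq0 -mulr2n mulrn_eq0 => /eqP.
have gxi i' k' := christoffel_xi i' k' Up.
move: i j k; apply: ord3P; apply: ord3P; apply: ord3P; rewrite ?diag ?gxi //;
  by rewrite skew ?gxi /= ?opprK // oppr0.
Qed.

Lemma np_christoffel_smooth p i j k : U p -> smooth_at p (G i j k).
Proof. exact: (christoffel_smooth gP lc np_frame_smooth). Qed.

Lemma np_christoffel_deriv p (v : tangent p) i j k : U p ->
  v (G i j k) = v (N i j k).
Proof.
move=> Up; apply: tangent_near; first exact: np_christoffel_smooth.
by apply: (open_near oU Up) => q; apply: np_christoffelE.
Qed.

Lemma np_ricciE p j k : U p ->
  ricci nabla (E j) (E k) p
  = \sum_(i < 3) (E i p (N j k i) - E j p (N i k i)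
      + \sum_(r < 3) (N j k r p * N i r i p - N i k r p * N j r i p
                - (N i j r p - N j i r p) * N r k i p)).
Proof.
move=> Up; rewrite (ricci_frame gP lc oU np_frame_smooth bE orthE _ _ Up).
apply: eq_bigr => i _; rewrite !np_christoffel_deriv //; congr (_ + _).
by apply: eq_bigr => r _; rewrite !(np_christoffelE _ _ _ Up).
Qed.

Lemma np_jacobi p (l : 'I_3) : U p ->
  let J (i j k : 'I_3) :=
    \sum_(r < 3) (N i j r p - N j i r p) * (N r k l p - N k r l p)
    - (E k p (N i j l) - E k p (N j i l)) in
  J i0 i1 i2 + J i1 i2 i0 + J i2 i0 i1 = 0.
Proof.
move=> Up; have := jacobi_frame gP lc oU np_frame_smooth bE orthE i0 i1 i2 l Up.
have S (i j k : 'I_3) :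
    \sum_(r < 3) (G i j r p - G j i r p) * (G r k l p - G k r l p)
    = \sum_(r < 3) (N i j r p - N j i r p) * (N r k l p - N k r l p).
  by apply: eq_bigr => r _; rewrite !(np_christoffelE _ _ _ Up).
by cbv beta zeta; rewrite !S !np_christoffel_deriv.
Qed.

Local Notation a := (G i0 i0 i1).
Local Notation b := (G i1 i0 i1).
Local Notation c := (G i2 i0 i1).

Let npE := (np_triple0, np_triple1, np_triple2).

(** Here [e1, e2] = - a e1 - b e2 + 2 alpha xi, so differentiating its three components along xi
    yields the three derivatives. The xi-component amounts to the closedness of d eta. *)
Lemma np_jacobi_coord p : U p ->
  [/\ xi A p alpha = - 2 * alpha p * beta p,
      xi A p a = e1 p c - beta p * a p + (alpha p + c p) * b p
                 - e2 p beta + e1 p alpha &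
      xi A p b = e2 p c - beta p * b p - (alpha p + c p) * a p
                 + e1 p beta + e2 p alpha].
Proof.
move=> Up; have [sal sbe _] := tsA.
have sa := np_christoffel_smooth i0 i0 i1 Up.
have sb := np_christoffel_smooth i1 i0 i1 Up.
have sc := np_christoffel_smooth i2 i0 i1 Up.
have {}sal := smooth_on_setT p sal; have {}sbe := smooth_on_setT p sbe.
have := np_jacobi i0 Up; have := np_jacobi i1 Up; have := np_jacobi i2 Up.
cbv beta zeta; rewrite !big_ord_recl !big_ord0 !npE /=.
rewrite !tangent_fN // !tangent_cst.
move=> J2 J1 J0; split; lra.
Qed.

Lemma np_ricci p : U p -> let S (i j : 'I_3) := ricci nabla (E i) (E j) p in
  [/\ S i0 i2 = - e1 p beta - e2 p alpha /\ S i1 i2 = e1 p alpha - e2 p beta,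
      S i2 i2 = - 2 * xi A p beta + 2 * alpha p ^+ 2 - 2 * beta p ^+ 2,
      S i0 i0 = e2 p a - e1 p b - 2 * beta p ^+ 2 - a p ^+ 2 - b p ^+ 2
                + 2 * alpha p * c p - xi A p beta,
      S i1 i1 = S i0 i0 &
      S i0 i1 = 0 /\ S i1 i0 = 0].
Proof.
move=> Up S; have [sal sbe _] := tsA.
have sa := np_christoffel_smooth i0 i0 i1 Up.
have sb := np_christoffel_smooth i1 i0 i1 Up.
have sc := np_christoffel_smooth i2 i0 i1 Up.
have {}sal := smooth_on_setT p sal; have {}sbe := smooth_on_setT p sbe.
have [J0 J1 J2] := np_jacobi_coord Up.
rewrite /S !np_ricciE // !big_ord_recl !big_ord0 !npE /=.
rewrite !tangent_fN // !tangent_cst.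
split; [split| | | |split].
(* Only S(e1, e2) and S(e2, e1) involve xi(alpha): they expand to xi(alpha) + 2 alpha beta and to
   its opposite. *)
all: rewrite ?J0.
all: ring.
Qed.


End NPFrame.

(** * Newman-Penrose coefficients *)

Section Complex.
Context {R : realType} {n : nat} {M : manifold R n}.

(** A common shape for d, dbar and xi, so that derivatives, connection and Ricci tensor are each
    expanded only once. *)
Definition cscale (x y : R) (X Y : vfield M) : cvfield M :=
  (fun p => x *: X p, fun p => y *: Y p).

Lemma real_fieldE (X : vfield M) : real_field X = cscale 1 0 X X.
Proof.
congr pair; apply: functional_extensionality_dep => q.
  by rewrite scale1r.
by rewrite scale0r.
Qed.

Lemma np_dE (e1 e2 : vfield M) :
  np_d e1 e2 = cscale (Num.sqrt 2)^-1 (- (Num.sqrt 2)^-1) e1 e2.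
Proof.
by congr pair; apply: functional_extensionality_dep => q; rewrite ?scaleNr.
Qed.

Lemma np_dbarE (e1 e2 : vfield M) :
  np_dbar e1 e2 = cscale (Num.sqrt 2)^-1 (Num.sqrt 2)^-1 e1 e2.
Proof. by []. Qed.

Lemma cderiv_cscale (x y : R) (X Y : vfield M) (f : M -> R[i])
    (u v : M -> R) p : smooth_at p u -> smooth_at p v ->
  (\forall q \near p, f q = Complex (u q) (v q)) ->
  cderiv (cscale x y X Y) f p
  = Complex (x * X p u - y * Y p v) (x * X p v + y * Y p u).
Proof.
move=> su sv fuv; rewrite /cderiv /vderiv !tangentZ.
have Re_near : \forall q \near p, u q = complex.Re (f q).
  by apply: filterS fuv => q ->.
have Im_near : \forall q \near p, v q = complex.Im (f q).
  by apply: filterS fuv => q ->.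
by rewrite -!(tangent_near _ su Re_near) -!(tangent_near _ sv Im_near).
Qed.

Context {g : tensor02 M} {nabla : vfield M -> vfield M -> vfield M}.
Context (gP : riemannian_metric g) (lc : levi_civita g nabla).

Lemma nablaZZ (x y : R) (X Y : vfield M) p : vsmooth_at p X -> vsmooth_at p Y ->
  nabla (fun q => x *: X q) (fun q => y *: Y q) p = (x * y) *: nabla X Y p.
Proof.
move=> sX sY; rewrite (nablaZl lc (smooth_at_cst p x)) //; last first.
  exact: vsmooth_atZ (smooth_at_cst p y) sY.
rewrite (nablaZr lc (smooth_at_cst p y)) // /vderiv tangent_cst.
by rewrite scale0r add0r scalerA.
Qed.

Lemma cmetric_cnabla (x y x' y' z w : R) (X Y X' Y' Z W : vfield M) p :
  vsmooth_at p X -> vsmooth_at p Y -> vsmooth_at p X' -> vsmooth_at p Y' ->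
  let G V V' V'' := g (nabla V V' p) (V'' p) in
  cmetric g (cscale z w Z W)
    (cnabla nabla (cscale x y X Y) (cscale x' y' X' Y')) p
  = Complex
      (z * (x * x' * G X X' Z - y * y' * G Y Y' Z)
       - w * (x * y' * G X Y' W + y * x' * G Y X' W))
      (z * (x * y' * G X Y' Z + y * x' * G Y X' Z)
       + w * (x * x' * G X X' W - y * y' * G Y Y' W)).
Proof.
move=> sX sY sX' sY' G; rewrite /cmetric /cform /= !nablaZZ //.
rewrite !(metricDr gP) !(metricNr gP) !(metricZr gP) !(metricZl gP).
rewrite /G !(Defs.metric_sym gP _ (nabla _ _ _)).
by congr Complex; ring.
Qed.

End Complex.

(** * Complex arithmetic by real and imaginary parts *)

Lemma ComplexN {R : rcfType} (a b : R) : - Complex a b = Complex (- a) (- b).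
Proof. by []. Qed.
Lemma ComplexD {R : rcfType} (a b c d : R) :
  Complex a b + Complex c d = Complex (a + c) (b + d).
Proof. by []. Qed.
Lemma ComplexM {R : rcfType} (a b c d : R) :
  Complex a b * Complex c d = Complex (a * c - b * d) (a * d + b * c).
Proof. by []. Qed.
Lemma Complex_conj {R : rcfType} (a b : R) : (Complex a b)^* = Complex a (- b).
Proof. by []. Qed.
Lemma Complex2 {R : rcfType} : 2 = Complex (2 : R) 0.
Proof. by rewrite -[RHS]/(2%:C%C) rmorph_nat. Qed.

Lemma sqrt2V_sqr (R : rcfType) :
  2 * ((Num.sqrt 2)^-1 * (Num.sqrt 2)^-1) = 1 :> R.
Proof. by rewrite -invfM -expr2 sqr_sqrtr // divff. Qed.

(** * Spin coefficients and complex Ricci tensor in terms of the real frame *)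

Section NPFrame.
Context {R : realType} {M : manifold R 3}.
Context (A : almost_contact_metric M).
Context {nabla : vfield M -> vfield M -> vfield M} {alpha beta : M -> R}.
Context (lc : levi_civita (metric A) nabla).
Context (tsA : trans_sasakian A nabla alpha beta).
Context {U : set M} {e1 e2 : vfield M} (npU : np_frame A U e1 e2).

Local Notation gP := (metricP A).
Local Notation i0 := (ord0 : 'I_3).
Local Notation i1 := (lift ord0 ord0 : 'I_3).
Local Notation i2 := (lift ord0 (lift ord0 ord0) : 'I_3).
Local Notation G :=
  (@christoffel _ _ _ (metric A) nabla _ (@np_triple R M A e1 e2)).
Local Notation s := ((Num.sqrt (2 : R))^-1).


Lemma np_coefE q : U q ->
  [/\ rho_np A nabla e1 e2 q = Complex (beta q) (alpha q),
      beta_np A nabla e1 e2 q = Complex (s * G i1 i0 i1 q) (s * G i0 i0 i1 q) &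
      epsilon_np A nabla e1 e2 q = Complex 0 (G i2 i0 i1 q)].
Proof.
move=> Uq; have [s1 s2] := np_smooth npU Uq; have sxi := xi_smooth A q.
have ss := sqrt2V_sqr R.
have N (i j k : 'I_3) := np_christoffelE lc tsA npU i j k Uq.
rewrite /christoffel in N.
rewrite /rho_np /beta_np /epsilon_np np_dE np_dbarE real_fieldE.
rewrite !(cmetric_cnabla gP lc) //.
(* The entries with last indices 0, 1 are left out: there the table returns the symbol itself. *)
have := (N i0 i2 i0, N i0 i2 i1, N i1 i2 i0, N i1 i2 i1).
have := (N i0 i0 i0, N i0 i1 i1, N i1 i1 i0, N i1 i0 i0, N i1 i1 i1,
  N i0 i1 i0, N i2 i0 i0, N i2 i1 i0, N i2 i1 i1).
rewrite /= !(np_triple0, np_triple1, np_triple2) => N1 N2.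
rewrite !{}N1 !{}N2 /christoffel !(np_triple0, np_triple1, np_triple2).
move: ss; set t := s => ss.
(* Multiplying the right-hand side by 2 t^2 = 1 gives both sides the same degree in [t], after which
   they agree as polynomials. *)
have K (x : R) : x = 2 * (t * t) * x by rewrite ss mul1r.
by split; congr Complex; rewrite [RHS]K; ring.
Qed.

Lemma np_cricci (x y x' y' : R) (X Y X' Y' : vfield M) p : U p ->
  vsmooth_at p X -> vsmooth_at p Y -> vsmooth_at p X' -> vsmooth_at p Y' ->
  let S V W := ricci nabla V W p in
  cricci nabla (cscale x y X Y) (cscale x' y' X' Y') p
  = Complex (x * x' * S X X' - y * y' * S Y Y')
            (x * y' * S X Y' + y * x' * S Y X').
Proof.
move=> Up sX sY sX' sY'; rewrite /cricci /cform /=.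
have E := ricciZZ gP lc (np_open npU) (np_frame_smooth npU) (np_basis npU)
  (np_triple_orth npU).
by rewrite !E.
Qed.

End NPFrame.

Theorem proposition4p7 (R : realType) (M : manifold R 3)
    (A : almost_contact_metric M)
    (nabla : vfield M -> vfield M -> vfield M)
    (alpha beta : M -> R) (U : set M) (e1 e2 : vfield M) :
  levi_civita (metric A) nabla ->
  trans_sasakian A nabla alpha beta ->
  np_frame A U e1 e2 ->
  let d := np_d e1 e2 in
  let dbar := np_dbar e1 e2 in
  let xi := real_field (xi A) in
  let rho := rho_np A nabla e1 e2 in
  let b := beta_np A nabla e1 e2 in
  let eps := epsilon_np A nabla e1 e2 in
  let S := cricci nabla in
  forall p : M, U p ->
  [/\ S d d p = 0,
      S d xi p = - cderiv d rho p /\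
      - cderiv d rho p
      = b p * (eps p - (rho p)^*) - cderiv xi b p + cderiv d eps p,
      S xi xi p = - 2 * cderiv xi rho p - 2 * rho p ^+ 2 &
      S d dbar p
      = - `|rho p| ^+ 2 - 2 * `|b p| ^+ 2 - (rho p - (rho p)^*) * eps p
        - cderiv xi rho p - rho p ^+ 2
        - cderiv d (fun q => (b q)^*) p - cderiv dbar b p].
Proof.
move=> lc tsA npU d dbar Xi rho b eps S p Up.
have [s1 s2] := np_smooth npU Up; have sxi := xi_smooth A p.
have [sal sbe _] := tsA.
have {}sal := smooth_on_setT p sal; have {}sbe := smooth_on_setT p sbe.
have oU := np_open npU.
pose i0 : 'I_3 := ord0; pose i1 : 'I_3 := lift ord0 ord0.
pose i2 : 'I_3 := lift ord0 (lift ord0 ord0).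
pose G := @christoffel _ _ _ (metric A) nabla _ (@np_triple R M A e1 e2).
pose a := G i0 i0 i1; pose b' := G i1 i0 i1; pose c := G i2 i0 i1.
have sG i j k : smooth_at p (G i j k) by exact: (np_christoffel_smooth lc npU).
have [J0 J1 J2] := np_jacobi_coord lc tsA npU Up.
have [[S02 S12] S22 S00 S11 [S01 S10]] := np_ricci lc tsA npU Up.
rewrite !(np_triple0, np_triple1, np_triple2) -/i0 -/i1 -/i2 -/a -/b' -/c
  in S02 S12 S22 S00 S11 S01 S10 J0 J1 J2.
pose t : R := (Num.sqrt 2)^-1.
have tt : 2 * (t * t) = 1 := sqrt2V_sqr R.
(* The coefficients are differentiated below, so their values are needed near [p] and not only at
   [p]. *)
have np_near : \forall q \near p, _ :=
  open_near oU Up (fun q => np_coefE lc tsA npU (q := q)).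
have sc0 := smooth_at_cst p (0 : R); have st := smooth_at_cst p t.
have srho (X : vfield M) Y x y : cderiv (cscale x y X Y) rho p
    = Complex (x * X p beta - y * Y p alpha) (x * X p alpha + y * Y p beta).
  by apply: cderiv_cscale => //; apply: filterS np_near => q [].
have sa : smooth_at p a := sG _ _ _.
have sb' : smooth_at p b' := sG _ _ _.
have sc : smooth_at p c := sG _ _ _.
have sta := smooth_atM st sa; have stb := smooth_atM st sb'.
have sb (X : vfield M) Y x y : cderiv (cscale x y X Y) b p
    = Complex (x * (t * X p b') - y * (t * Y p a))
              (x * (t * X p a) + y * (t * Y p b')).
  rewrite (cderiv_cscale _ _ _ _ stb sta); last first.
    by apply: filterS np_near => q [].
  by rewrite !tangent_fZ.
have sbc (X : vfield M) Y x y : cderiv (cscale x y X Y) (fun q => (b q)^*) p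
    = Complex (x * (t * X p b') + y * (t * Y p a))
              (y * (t * Y p b') - x * (t * X p a)).
  rewrite (cderiv_cscale _ _ _ _ stb (smooth_atN sta)); last first.
    by apply: filterS np_near => q [_ bq _]; rewrite [b q]bq.
  by rewrite !tangent_fN // !tangent_fZ //; congr Complex; ring.
have seps (X : vfield M) Y x y : cderiv (cscale x y X Y) eps p
    = Complex (- (y * Y p c)) (x * X p c).
  rewrite (cderiv_cscale _ _ _ _ sc0 sc); last first.
    by apply: filterS np_near => q [].
  by rewrite !tangent_cst !mulr0 sub0r addr0.
have [rhop bp epsp] := nbhs_singleton np_near.
rewrite /d /dbar /Xi np_dE np_dbarE real_fieldE !srho !sb !sbc !seps.
rewrite /S !(np_cricci lc npU) // S00 S11 S00 S22 S01 S10 S02 S12 !normCK.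
(* [J0] makes the imaginary part of xi(rho) cancel that of rho^2; [J1] and [J2] replace the
   derivatives along xi that occur in xi(b). *)
rewrite [rho p]rhop [b p]bp [eps p]epsp -/t J0 J1 J2.
rewrite -/i0 -/i1 -/i2 -/G -/a -/b' -/c.
rewrite !expr2 !Complex_conj !Complex2 !(ComplexN, ComplexD, ComplexM).
have e0 : (0 : R[i]) = Complex 0 0 by [].
rewrite {1}e0.
split; [|split| |].
- congr Complex; ring.
- congr Complex; ring.
- congr Complex; ring.
- congr Complex; ring.
- congr Complex; last ring.
  (* The second factor collects the terms of S(e1, e1) which carry t ^ 2, where
     t = 1 / sqrt 2, on the left-hand side but not on the right-hand side. *)
  apply: subr0_eq.
  rewrite (_ : _ - _ = (2 * (t * t) - 1)
    * (2 * alpha p * c p - 2 * beta p ^+ 2 - xi A p beta)); last ring.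
  by rewrite tt subrr mul0r.
Qed.
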